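(* Let $h,k\in\mathrm{QS}(S^1)$ be distinct, and regard $V_h$ and $V_k$ as operators on $H^{1/2}(S^1)$. Then $$\|V_h-V_k\|_{\mathrm e}\;\ge\;\bigl(m(V_h)^2+m(V_k)^2\bigr)^{1/2}=\bigl(\|V_h^{-1}\|^{-2}+\|V_k^{-1}\|^{-2}\bigr)^{1/2}.$$ In particular, the family $\{V_h:h\in\mathrm{QS}(S^1)\}$ is discrete in essential norm, and hence also in operator norm.
   Context: $S^1$ is the unit circle. An orientation-preserving homeomorphism $h:S^1\to S^1$ is quasisymmetric if there is $M\ge1$ with $M^{-1}\le |h(I_1)|/|h(I_2)|\le M$ whenever $I_1,I_2$ are adjacent arcs of equal length ($|I|$ denotes arc length); $\mathrm{QS}(S^1)$ is the group of all such homeomorphisms. $H^{1/2}(S^1)$ is the Hilbert space of (classes modulo constants of) complex-valued functions $u$ on $S^1$ with $\|u\|_{H^{1/2}}^2=\sum_{n\ne0}|n||\widehat u(n)|^2<\infty$, where $\widehat u(n)=\frac1{2\pi}\int_0^{2\pi}u(e^{i\theta})e^{-in\theta}\,d\theta$. For $h\in\mathrm{QS}(S^1)$ the pull-back $V_hu=u\circ h$ is a bounded invertible operator on $H^{1/2}(S^1)$ with $V_h^{-1}=V_{h^{-1}}$ (theorem of Nag and Sullivan). For a bounded operator $T$ on a Banach space $E$, $\|T\|_{\mathrm e}=\inf\{\|T-K\|:K\text{ compact on }E\}$ is the essential norm; for invertible $T$, $m(T)=\inf_{\|u\|=1}\|Tu\|=\|T^{-1}\|^{-1}$ is the minimum modulus.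 *)

(* Defs.v *)
From HB Require Import structures.
From mathcomp Require Import all_boot all_order all_algebra.
From mathcomp Require Import generic_quotient ring_quotient complex.
From mathcomp Require Import all_classical all_reals all_analysis.
From mathcomp Require Import measurable_realfun ring lra.

Set Implicit Arguments.
Unset Strict Implicit.
Unset Printing Implicit Defensive.

Import Order.TTheory GRing.Theory Num.Theory.
Import numFieldTopology.Exports numFieldNormedType.Exports.
Import Normc.
Local Notation Re := complex.Re.
Local Notation Im := complex.Im.

Local Open Scope classical_set_scope.
Local Open Scope complex_scope.
Local Open Scope ring_scope.

Definition unit_circle (R : realType) : set (R[i])^o := [set z | `|z| = 1].

Arguments unit_circle R : clear implicits.

Section circle.
Context {R : realType}.
Implicit Types (t : R) (z w : unit_circle R).

Lemma normc_exp t : `|(cos t +i* sin t : R[i])| = 1.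
Proof. by rewrite normc_def/= cos2Dsin2 sqrtr1. Qed.

(* e^{it} as a point of the circle, and rot z t = z e^{it} *)
Definition expi t : unit_circle R := SigSub (mem_set (normc_exp t)).

Lemma rot_subproof z t : `|(val z * val (expi t) : R[i])| = 1.
Proof. by rewrite normrM normc_exp mulr1; exact: (set_mem (valP z)). Qed.

Definition rot z t : unit_circle R := SigSub (mem_set (rot_subproof z t)).

End circle.

Section complex_integral.
Context {R : realType}.
Local Notation mu := (@lebesgue_measure R).
Implicit Types (D : set R) (f g : R -> R[i]).

Definition cintegrable D f : Prop :=
  mu.-integrable D (EFin \o (fun t => Re (f t))) /\
  mu.-integrable D (EFin \o (fun t => Im (f t))).

Definition cint D f : R[i] :=
  (\int[mu]_(t in D) Re (f t)) +i* (\int[mu]_(t in D) Im (f t)).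

Lemma integrable_lin D (a b : R) (f g : R -> R) : measurable D ->
  mu.-integrable D (EFin \o f) -> mu.-integrable D (EFin \o g) ->
  mu.-integrable D (EFin \o (fun t => a * f t + b * g t)).
Proof.
move=> mD fi gi.
have -> : EFin \o (fun t => a * f t + b * g t) =
    ((fun t => a%:E * (EFin \o f) t) \+ (fun t => b%:E * (EFin \o g) t))%E.
  by apply/funext => t.
by apply: integrableD => //; apply: integrableZl.
Qed.

Lemma Rintegral_lin D (a b : R) (f g : R -> R) : measurable D ->
  mu.-integrable D (EFin \o f) -> mu.-integrable D (EFin \o g) ->
  \int[mu]_(t in D) (a * f t + b * g t) =
  a * \int[mu]_(t in D) f t + b * \int[mu]_(t in D) g t.
Proof.
move=> mD fi gi; rewrite RintegralD//.
- by rewrite !RintegralZl.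
- have -> : EFin \o (fun t => a * f t) = (fun t => a%:E * (EFin \o f) t)%E by [].
  exact: integrableZl.
- have -> : EFin \o (fun t => b * g t) = (fun t => b%:E * (EFin \o g) t)%E by [].
  exact: integrableZl.
Qed.

Lemma ReZ (a z : R[i]) : Re (a * z) = Re a * Re z + - Im a * Im z.
Proof. by case: a z => [a b] [c d] /=; rewrite mulNr. Qed.

Lemma ImZ (a z : R[i]) : Im (a * z) = Im a * Re z + Re a * Im z.
Proof. by case: a z => [a b] [c d] /=; rewrite addrC [b * c]mulrC mulrC. Qed.

Lemma cintegrableD D f g : measurable D -> cintegrable D f ->
  cintegrable D g -> cintegrable D (fun t => f t + g t).
Proof.
move=> mD [f1 f2] [g1 g2]; split.
- have -> : EFin \o (fun t => Re (f t + g t)) =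
    EFin \o (fun t => 1 * Re (f t) + 1 * Re (g t)).
    by apply/funext => t /=; case: (f t) (g t) => [? ?] [? ?] /=; rewrite !mul1r.
  exact: integrable_lin.
- have -> : EFin \o (fun t => Im (f t + g t)) =
    EFin \o (fun t => 1 * Im (f t) + 1 * Im (g t)).
    by apply/funext => t /=; case: (f t) (g t) => [? ?] [? ?] /=; rewrite !mul1r.
  exact: integrable_lin.
Qed.

Lemma cintegrableZ D a f : measurable D -> cintegrable D f ->
  cintegrable D (fun t => a * f t).
Proof.
move=> mD [f1 f2]; split.
- under [X in EFin \o X]funext do rewrite ReZ; exact: integrable_lin.
- under [X in EFin \o X]funext do rewrite ImZ; exact: integrable_lin.
Qed.

Lemma cintD D f g : measurable D -> cintegrable D f ->
  cintegrable D g -> cint D (fun t => f t + g t) = cint D f + cint D g.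
Proof.
move=> mD [f1 f2] [g1 g2]; rewrite /cint; simpc; congr (_ +i* _).
  transitivity (\int[mu]_(t in D) (1 * Re (f t) + 1 * Re (g t))).
    congr Rintegral; apply/funext => t.
    by case: (f t) (g t) => [? ?] [? ?] /=; rewrite !mul1r.
  by rewrite Rintegral_lin// !mul1r.
transitivity (\int[mu]_(t in D) (1 * Im (f t) + 1 * Im (g t))).
  congr Rintegral; apply/funext => t.
  by case: (f t) (g t) => [? ?] [? ?] /=; rewrite !mul1r.
by rewrite Rintegral_lin// !mul1r.
Qed.

Lemma cintZ D a f : measurable D -> cintegrable D f ->
  cint D (fun t => a * f t) = a * cint D f.
Proof.
move=> mD [f1 f2]; rewrite /cint; apply/eqP; rewrite eq_complex ReZ ImZ/=.
apply/andP; split; apply/eqP.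
  rewrite -Rintegral_lin//; congr Rintegral; apply/funext => t.
  by rewrite ReZ.
rewrite -Rintegral_lin//; congr Rintegral; apply/funext => t.
by rewrite ImZ.
Qed.

End complex_integral.

Section half_order_functions.
Context {R : realType}.
Local Notation C := R[i].
Local Notation S1 := (unit_circle R).
Local Notation circ := (`[0, 2 * pi]%classic : set R).
Implicit Types (u v : S1 -> C) (n : int).

(* The n-th Fourier coefficient of z |-> u z on the circle: the factor
   [val (expi (- (n%:~R * t)))] is e^{-int}. *)
Definition fourier u n : C :=
  ((2 * pi)^-1)%:C *
  cint circ (fun t => u (expi t) * val (expi (- (n%:~R * t)))).

Definition Hhalf_sqr u : \bar R :=
  \esum_(n in [set n : int | n != 0]) ((`|n|%:~R * normc (fourier u n) ^+ 2)%:E).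

Definition Hhalf_mem u : Prop :=
  cintegrable circ (u \o expi) /\ (Hhalf_sqr u < +oo)%E.

Let mcirc : measurable circ. Proof. exact: measurable_itv. Qed.

Lemma bounded_circ (f : R -> R) : (forall t, `|f t| <= 1) ->
  [bounded f t | t in circ].
Proof.
move=> f1; exists 1; split => // M M1 t _ /=.
exact: le_trans (f1 t) (ltW M1).
Qed.

Lemma integrable_mulb (f h : R -> R) :
  (@lebesgue_measure R).-integrable circ (EFin \o f) ->
  measurable_fun circ h -> [bounded h t | t in circ] ->
  (@lebesgue_measure R).-integrable circ (EFin \o (fun t => f t * h t)).
Proof.
move=> fi mh bh.
by have := @integrableMl _ _ _ (@lebesgue_measure R) circ mcirc _ h fi mh bh.
Qed.

Lemma cintegrable_fourier u n : cintegrable circ (u \o expi) ->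
  cintegrable circ (fun t => u (expi t) * val (expi (- (n%:~R * t)))).
Proof.
have cN : continuous (fun t : R => - (n%:~R * t)).
  by move=> t; apply: cvgN; apply: cvgMr; exact: cvg_id.
have mcos : measurable_fun circ (fun t : R => cos (- (n%:~R * t))).
  apply: subspace_continuous_measurable_fun => //.
  apply: continuous_subspaceT => t.
  by apply: continuous_comp; [exact: cN|exact: continuous_cos].
have msin : measurable_fun circ (fun t : R => sin (- (n%:~R * t))).
  apply: subspace_continuous_measurable_fun => //.
  apply: continuous_subspaceT => t.
  by apply: continuous_comp; [exact: cN|exact: continuous_sin].
have bcos : [bounded cos (- (n%:~R * t)) | t in circ].
  by apply: bounded_circ => t; exact: cos_max.
have bsin : [bounded sin (- (n%:~R * t)) | t in circ].
  by apply: bounded_circ => t; exact: sin_max.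
move=> [u1 u2]; split.
  rewrite [X in integrable _ _ X](_ : _ = EFin \o
    (fun t => 1 * (Re (u (expi t)) * cos (- (n%:~R * t))) +
              (-1) * (Im (u (expi t)) * sin (- (n%:~R * t))))); last first.
    apply/funext => t /=; case: (u (expi t)) => a b /=.
    by rewrite mul1r mulN1r.
  apply: integrable_lin => //.
    exact: integrable_mulb u1 mcos bcos.
  exact: integrable_mulb u2 msin bsin.
rewrite [X in integrable _ _ X](_ : _ = EFin \o
    (fun t => 1 * (Re (u (expi t)) * sin (- (n%:~R * t))) +
              1 * (Im (u (expi t)) * cos (- (n%:~R * t))))); last first.
  apply/funext => t /=; case: (u (expi t)) => a b /=.
  by rewrite !mul1r.
apply: integrable_lin => //.
  exact: integrable_mulb u1 msin bsin.
exact: integrable_mulb u2 mcos bcos.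
Qed.

Lemma fourierD u v n : cintegrable circ (u \o expi) ->
  cintegrable circ (v \o expi) ->
  fourier (fun z => u z + v z) n = fourier u n + fourier v n.
Proof.
move=> iu iv; rewrite /fourier -mulrDr -cintD//; last 2 first.
- exact: cintegrable_fourier.
- exact: cintegrable_fourier.
by congr (_ * cint _ _); apply/funext => t; rewrite mulrDl.
Qed.

Lemma fourierZ (a : C) u n : cintegrable circ (u \o expi) ->
  fourier (fun z => a * u z) n = a * fourier u n.
Proof.
move=> iu; rewrite /fourier mulrCA -(cintZ a)//; last exact: cintegrable_fourier.
by congr (_ * cint _ _); apply/funext => t; rewrite mulrA.
Qed.

Lemma normc_ge0 (x : C) : 0 <= normc x.
Proof. by case: x => a b /=; exact: sqrtr_ge0. Qed.

Lemma normc_triangle (x y : C) : normc (x + y) <= normc x + normc y.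
Proof.
by case: x y => [a b] [c d]; rewrite -lecR rmorphD; exact: (ler_normD (a +i* b) (c +i* d)).
Qed.

Lemma esumZl (c : R) (D : set int) (a : int -> \bar R) : 0 <= c ->
  (forall n, 0 <= a n)%E ->
  (\esum_(n in D) (c%:E * a n) = c%:E * \esum_(n in D) a n)%E.
Proof.
move=> c0 a0; rewrite /esum -ereal_supZl//; last first.
  by apply/set0P; exists (\sum_(x \in set0) a x)%E; exists set0 => //; exact: fsets_set0.
congr ereal_sup; rewrite image_comp/=; apply: eq_imagel => A _ /=.
by rewrite ge0_mule_fsumr.
Qed.

Lemma Hterm_ge0 u n : (0 <= (`|n|%:~R * normc (fourier u n) ^+ 2)%:E)%E.
Proof. by rewrite lee_fin mulr_ge0// ?ler0z// exprn_ge0 ?normc_ge0. Qed.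

Lemma Hhalf_sqr_ge0 u : (0 <= Hhalf_sqr u)%E.
Proof. by apply: esum_ge0 => n _; exact: Hterm_ge0. Qed.

Lemma Hhalf_sqrZ (a : C) u : cintegrable circ (u \o expi) ->
  Hhalf_sqr (fun z => a * u z) = ((normc a ^+ 2)%:E * Hhalf_sqr u)%E.
Proof.
move=> iu; rewrite /Hhalf_sqr -esumZl//; last 2 first.
- by rewrite exprn_ge0 ?normc_ge0.
- by move=> n; exact: Hterm_ge0.
apply: eq_esum => n _; rewrite -EFinM fourierZ// normcM exprMn.
by rewrite mulrCA.
Qed.

Lemma Hhalf_sqrD (t : R) u v : 0 < t -> cintegrable circ (u \o expi) ->
  cintegrable circ (v \o expi) ->
  (Hhalf_sqr (fun z => u z + v z)%R <=
   (1 + t)%:E * Hhalf_sqr u + (1 + t^-1)%:E * Hhalf_sqr v)%E.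
Proof.
move=> t0 iu iv; have ti0 : 0 < t^-1 by rewrite invr_gt0.
rewrite /Hhalf_sqr -!esumZl//; last 4 first.
- by rewrite addr_ge0// ltW.
- by move=> n; exact: Hterm_ge0.
- by rewrite addr_ge0// ltW.
- by move=> n; exact: Hterm_ge0.
rewrite -esumD; last 2 first.
- by move=> n _; rewrite mule_ge0 ?Hterm_ge0// lee_fin addr_ge0// ltW.
- by move=> n _; rewrite mule_ge0 ?Hterm_ge0// lee_fin addr_ge0// ltW.
apply: le_esum => n _; rewrite fourierD// -!EFinM -EFinD lee_fin.
set x := fourier u n; set y := fourier v n; set k := (`|n|%:~R : R).
have k0 : 0 <= k by rewrite ler0z.
rewrite [leRHS](_ : _ = k * ((1 + t) * normc x ^+ 2 +
  (1 + t^-1) * normc y ^+ 2)); last by ring.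
rewrite ler_wpM2l//.
apply: (@le_trans _ _ ((normc x + normc y) ^+ 2)).
  by rewrite lerXn2r ?nnegrE ?addr_ge0 ?normc_ge0 ?normc_triangle.
set a := normc x; set b := normc y; rewrite -subr_ge0.
rewrite (_ : _ - _ = t^-1 * (t * a - b) ^+ 2); last first.
  by field; rewrite gt_eqF.
by rewrite mulr_ge0 ?sqr_ge0// ltW.
Qed.

Definition Hhalf_pred : {pred S1 -> C^o} := fun u => `[< Hhalf_mem u >].

Lemma Hhalf_submod : submod_closed Hhalf_pred.
Proof.
have memD u v : Hhalf_mem u -> Hhalf_mem v -> Hhalf_mem (fun z => u z + v z).
  move=> [iu fu] [iv fv]; split; first exact: cintegrableD.
  apply: le_lt_trans (Hhalf_sqrD ltr01 iu iv) _.
  by rewrite lte_add_pinfty// lte_mul_pinfty ?lee_fin ?addr_ge0 ?invr_ge0//.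
have memZ a u : Hhalf_mem u -> Hhalf_mem (fun z => a * u z).
  move=> [iu fu]; split; first exact: cintegrableZ.
  by rewrite Hhalf_sqrZ// lte_mul_pinfty ?lee_fin ?exprn_ge0 ?normc_ge0.
have mem0 : Hhalf_mem (fun=> 0).
  have i0 : cintegrable circ (cst 0 \o expi).
    split; rewrite [X in integrable _ _ X](_ : _ = cst 0%E)//; exact: integrable0.
  split => //; rewrite (_ : (fun=> 0) = (fun z : S1 => 0 * (0 : C))); last first.
    by apply/funext => z; rewrite mul0r.
  by rewrite Hhalf_sqrZ// normc0 expr0n/= mul0e ltry.
split; first exact/asboolP.
move=> a u v /asboolP hu /asboolP hv; apply/asboolP; exact: memD (memZ a _ hu) hv.
Qed.

HB.instance Definition _ :=
  GRing.isSubmodClosed.Build C (S1 -> C^o) Hhalf_pred Hhalf_submod.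

End half_order_functions.

Record HalfFun (R : realType) := MkHalfFun {
  halffun :> unit_circle R -> (R[i])^o;
  _ : halffun \in @Hhalf_pred R
}.

HB.instance Definition _ R := [isSub for @halffun R].
HB.instance Definition _ R := [Choice of HalfFun R by <:].
HB.instance Definition _ R :=
  [SubChoice_isSubLmodule of HalfFun R by <:].

Section Hhalf.
Context {R : realType}.
Local Notation C := R[i].
Implicit Types (u v : HalfFun R).

Lemma HalfFun_cintegrable u : cintegrable `[0, 2 * pi] (u \o expi).
Proof. by case: u => u /= /asboolP[]. Qed.

Lemma Hhalf_sqr_fin u : (Hhalf_sqr u < +oo)%E.
Proof. by case: u => u /= /asboolP[]. Qed.

Definition Hhalf_seminorm u : R := Num.sqrt (fine (Hhalf_sqr u)).

Lemma Hhalf_seminormK u : Hhalf_sqr u = (Hhalf_seminorm u ^+ 2)%:E.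
Proof.
have f : Hhalf_sqr u \is a fin_num by rewrite ge0_fin_numE ?Hhalf_sqr_ge0 ?Hhalf_sqr_fin.
by rewrite sqr_sqrtr ?fine_ge0 ?Hhalf_sqr_ge0// fineK.
Qed.

Lemma Hhalf_seminorm_ge0 u : 0 <= Hhalf_seminorm u.
Proof. exact: sqrtr_ge0. Qed.

Lemma Hhalf_seminormZ (a : C) u :
  Hhalf_seminorm (a *: u) = normc a * Hhalf_seminorm u.
Proof.
rewrite {1}/Hhalf_seminorm.
have -> : Hhalf_sqr (a *: u) = ((normc a ^+ 2)%:E * Hhalf_sqr u)%E.
  rewrite -Hhalf_sqrZ; first by congr Hhalf_sqr.
  exact: HalfFun_cintegrable.
rewrite Hhalf_seminormK -EFinM/= -exprMn sqrtr_sqr ger0_norm//.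
by rewrite mulr_ge0// ?normc_ge0 ?sqrtr_ge0.
Qed.

Lemma young_le (a b s : R) : 0 <= a -> 0 <= b -> 0 <= s ->
  (forall t, 0 < t -> s ^+ 2 <= (1 + t) * a ^+ 2 + (1 + t^-1) * b ^+ 2) ->
  s <= a + b.
Proof.
move=> a0 b0 s0 H; apply/ler_addgt0Pr => e e0.
pose a' := a + e / 2; pose b' := b + e / 2.
have a'0 : 0 < a' by rewrite /a'; lra.
have b'0 : 0 < b' by rewrite /b'; lra.
have t0 : 0 < b' / a' by rewrite divr_gt0.
have -> : a + b + e = a' + b' by rewrite /a' /b'; lra.
suff : s ^+ 2 <= (a' + b') ^+ 2.
  by rewrite ler_pXn2r// nnegrE addr_ge0// ltW.
apply: (le_trans (H _ t0)).
have -> : (a' + b') ^+ 2 =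
    (1 + b' / a') * a' ^+ 2 + (1 + (b' / a')^-1) * b' ^+ 2.
  by field; rewrite !gt_eqF.
have aa' : a <= a' by rewrite /a'; lra.
have bb' : b <= b' by rewrite /b'; lra.
apply: lerD; apply: ler_wpM2l.
- by rewrite addr_ge0// ltW.
- by rewrite lerXn2r// nnegrE// ltW.
- by rewrite addr_ge0// invr_ge0 ltW.
- by rewrite lerXn2r// nnegrE// ltW.
Qed.

Lemma esqr_le (S A B : \bar R) (s a b x y : R) :
  S = (s ^+ 2)%:E -> A = (a ^+ 2)%:E -> B = (b ^+ 2)%:E ->
  (S <= x%:E * A + y%:E * B)%E -> s ^+ 2 <= x * a ^+ 2 + y * b ^+ 2.
Proof. by move=> -> -> ->; rewrite -!EFinM -EFinD lee_fin. Qed.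

Lemma Hhalf_seminormD u v :
  Hhalf_seminorm (u + v) <= Hhalf_seminorm u + Hhalf_seminorm v.
Proof.
apply: young_le; try exact: Hhalf_seminorm_ge0.
move=> t t0; apply: (esqr_le (Hhalf_seminormK (u + v)) (Hhalf_seminormK u)
  (Hhalf_seminormK v)).
exact: Hhalf_sqrD t0 (HalfFun_cintegrable u) (HalfFun_cintegrable v).
Qed.

(* By uniqueness of Fourier coefficients, the null vectors of the seminorm are
   the functions that are a.e. equal to a constant, so the quotient below is
   the space of functions modulo constants (and modulo a.e. equality). *)
Definition Hhalf_null : {pred HalfFun R} := fun u => Hhalf_seminorm u == 0.

Lemma Hhalf_seminormN u : Hhalf_seminorm (- u) = Hhalf_seminorm u.
Proof.
rewrite -scaleN1r Hhalf_seminormZ.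
suff -> : normc (-1 : C) = 1 by rewrite mul1r.
by rewrite /= oppr0 expr0n/= addr0 sqrrN expr1n sqrtr1.
Qed.

Lemma Hhalf_null_zmod : zmod_closed Hhalf_null.
Proof.
split.
  by rewrite unfold_in -(scale0r (0 : HalfFun R)) Hhalf_seminormZ normc0 mul0r.
move=> u v; rewrite !unfold_in => /eqP u0 /eqP v0.
rewrite eq_le Hhalf_seminorm_ge0 andbT.
by rewrite (le_trans (Hhalf_seminormD _ _))// Hhalf_seminormN u0 v0 addr0.
Qed.

HB.instance Definition _ :=
  GRing.isZmodClosed.Build (HalfFun R) Hhalf_null Hhalf_null_zmod.

End Hhalf.

Definition Hhalf (R : realType) : Type :=
  Quotient.quot (@Hhalf_null R : zmodClosed _).
HB.instance Definition _ R := GRing.Zmodule.on (Hhalf R).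
HB.instance Definition _ R := EqQuotient.on (Hhalf R).

Definition Hclass {R : realType} (u : HalfFun R) : Hhalf R := (\pi u)%qT.

Section Hhalf_norm.
Context {R : realType}.
Local Notation C := R[i].
Implicit Types (u v : HalfFun R) (x y : Hhalf R).

Lemma Hclass_eq u v : Hclass u = Hclass v <-> Hhalf_seminorm (u - v) = 0.
Proof.
split=> [/eqP|/eqP uv].
  by rewrite -Quotient.idealrBE unfold_in => /eqP.
by apply/eqP; rewrite -Quotient.idealrBE unfold_in.
Qed.

Lemma HclassP x : exists u, Hclass u = x.
Proof. by exists (repr x); exact: reprK. Qed.

Lemma HclassD u v : Hclass (u + v) = Hclass u + Hclass v.
Proof. exact: raddfD. Qed.

Definition Hscale (a : C) x : Hhalf R := Hclass (a *: repr x).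

Lemma HclassZ (a : C) u : Hclass (a *: u) = Hscale a (Hclass u).
Proof.
apply/Hclass_eq; rewrite -scalerBr Hhalf_seminormZ.
suff -> : Hhalf_seminorm (u - repr (Hclass u)) = 0 by rewrite mulr0.
by apply/Hclass_eq; rewrite [RHS]reprK.
Qed.

Lemma Hscale_assoc (a b : C) x : Hscale a (Hscale b x) = Hscale (a * b) x.
Proof. by have [u <-] := HclassP x; rewrite -!HclassZ scalerA. Qed.
Lemma Hscale1 : left_id 1 Hscale.
Proof. by move=> x; have [u <-] := HclassP x; rewrite -HclassZ scale1r. Qed.
Lemma HscaleDr : right_distributive Hscale +%R.
Proof.
move=> a x y; have [u <-] := HclassP x; have [v <-] := HclassP y.
by rewrite -HclassD -!HclassZ -HclassD scalerDr.
Qed.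
Lemma HscaleDl x : {morph Hscale^~ x : a b / a + b}.
Proof.
by move=> a b; have [u <-] := HclassP x; rewrite -!HclassZ -HclassD scalerDl.
Qed.

HB.instance Definition _ := GRing.Zmodule_isLmodule.Build C (Hhalf R)
  Hscale_assoc Hscale1 HscaleDr HscaleDl.

Definition Hhalf_norm x : C := (Hhalf_seminorm (repr x))%:C.

Lemma Hhalf_norm_class u : Hhalf_norm (Hclass u) = (Hhalf_seminorm u)%:C.
Proof.
have le v w : Hclass v = Hclass w -> Hhalf_seminorm v <= Hhalf_seminorm w.
  move=> /Hclass_eq vw; rewrite -[v](subrK w).
  by rewrite (le_trans (Hhalf_seminormD _ _))// vw add0r.
have e : Hclass (repr (Hclass u)) = Hclass u by exact: reprK.
congr (_%:C); apply/eqP; rewrite eq_le !le//.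
Qed.

Lemma Hhalf_normD x y : Hhalf_norm (x + y) <= Hhalf_norm x + Hhalf_norm y.
Proof.
have [u <-] := HclassP x; have [v <-] := HclassP y.
by rewrite -HclassD !Hhalf_norm_class -rmorphD lecR Hhalf_seminormD.
Qed.

Lemma Hhalf_normZ (a : C) x : Hhalf_norm (a *: x) = `|a| * Hhalf_norm x.
Proof.
have [u <-] := HclassP x.
have -> : a *: Hclass u = Hclass (a *: u) by rewrite HclassZ.
rewrite !Hhalf_norm_class Hhalf_seminormZ rmorphM; congr (_ * _).
Qed.

Lemma Hhalf_norm0_eq0 x : Hhalf_norm x = 0 -> x = 0.
Proof.
have [u <-] := HclassP x; rewrite Hhalf_norm_class => -[u0].
by rewrite -[RHS](raddf0 Hclass); apply/Hclass_eq; rewrite subr0.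
Qed.

HB.instance Definition _ := Lmodule_isNormed.Build C (Hhalf R)
  Hhalf_normD Hhalf_normZ Hhalf_norm0_eq0.

End Hhalf_norm.

Lemma Re_norm_Hclass (R : realType) (u : HalfFun R) :
  Re `|Hclass u| = Hhalf_seminorm u.
Proof. by rewrite [`|_|]Hhalf_norm_class. Qed.

(* The norm of a normedModType over R[i] takes its values in R[i] (it is a
   nonnegative real there); Re brings it back to R. *)
Section operators.
Context {R : realType} {E : normedModType R[i]}.
Implicit Types (T : E -> E) (K : {linear E -> E}).

Definition op_norm T : R := sup [set Re `|T x| | x in [set x | `|x| <= 1]].

Definition compact_operator K : Prop :=
  compact (closure (K @` [set x | `|x| <= 1])).

Definition ess_norm T : R :=
  inf [set op_norm (T \- K) | K in compact_operator].

Definition min_modulus T : R := inf [set Re `|T x| | x in [set x | `|x| = 1]].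

Definition inverse_operator (T S : {linear E -> E}) : Prop :=
  cancel T S /\ cancel S T.

Definition bounded_invertible (T : {linear E -> E}) : Prop :=
  continuous T /\
  exists S : {linear E -> E}, continuous S /\ inverse_operator T S.

End operators.

Section quasisymmetric.
Context {R : realType}.
Local Notation S1 := (unit_circle R).
Implicit Types (h : S1 -> S1) (A : set S1).

Definition homeomorphism h : Prop :=
  continuous h /\
  exists g : S1 -> S1, [/\ continuous g, cancel h g & cancel g h].

(* h lifts to an increasing map of the line *)
Definition orientation_preserving h : Prop :=
  exists phi : R -> R, [/\ continuous phi, {homo phi : s t / s < t} &
    forall t, h (expi t) = expi (phi t)].

Definition arc (a l : R) : set S1 := expi @` `[a, a + l].

Definition arclength A : R :=
  fine (lebesgue_measure (`[0, 2 * pi[ `&` expi @^-1` A)).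

(* Two adjacent arcs of the same length l (0 < l <= pi) are, up to order,
   [arc a l] and [arc (a + l) l]. *)
Definition quasisymmetric h : Prop :=
  [/\ homeomorphism h, orientation_preserving h &
    exists2 M : R, 1 <= M & forall a l : R, 0 < l <= pi ->
      M^-1 <= arclength (h @` arc a l) / arclength (h @` arc (a + l) l) <= M].

End quasisymmetric.

Section pullback.
Context {R : realType}.
Local Notation S1 := (unit_circle R).
Implicit Types (u : S1 -> R[i]) (z : S1) (h : S1 -> S1).

Definition mean u z (r : R) : R[i] :=
  ((2 * r)^-1)%:C * cint `[- r, r] (fun t => u (rot z t)).

(* A quasisymmetric h may map Lebesgue null sets to sets of positive measure,
   so that u \o h is not determined by the a.e. class of u.  As usual, u is
   therefore evaluated through its precise representative, the limit of its
   means over shrinking arcs; it equals u at each point of continuity of u, and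
   for u in H^{1/2} the limit exists off a set of zero capacity, a class of
   sets that h preserves. *)
Definition precise u z : R[i] :=
  lim (Re (mean u z r) @[r --> 0^'+]) +i* lim (Im (mean u z r) @[r --> 0^'+]).

(* V is the operator V_h u = u \o h, which is bounded and invertible on
   H^{1/2} when h is quasisymmetric, by the theorem of Nag and Sullivan. *)
Definition pullback_operator h (V : {linear Hhalf R -> Hhalf R}) : Prop :=
  bounded_invertible V /\
  forall u : HalfFun R, exists2 v : HalfFun R,
    V (Hclass u) = Hclass v & forall z, v z = precise u (h z).

(* The family of the V_h, h quasisymmetric, is discrete for the distance
   N (V - W). *)
Definition pullbacks_discrete (N : (Hhalf R -> Hhalf R) -> R) : Prop :=
  forall h (V : {linear Hhalf R -> Hhalf R}),
    quasisymmetric h -> pullback_operator h V ->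
    exists2 e : R, 0 < e &
      forall k (W : {linear Hhalf R -> Hhalf R}),
        quasisymmetric k -> pullback_operator k W ->
        N (V \- W) < e -> k = h.

End pullback.

(* Main.v *)
Require Import Defs.
From mathcomp Require Import all_boot all_order all_algebra complex.
From mathcomp Require Import all_classical all_reals all_analysis.
From mathcomp Require Import measurable_realfun ring lra.

Import Order.TTheory GRing.Theory Num.Theory.
Import numFieldTopology.Exports numFieldNormedType.Exports.
Import Normc.

Local Open Scope classical_set_scope.
Local Open Scope ring_scope.

Set Implicit Arguments.
Unset Strict Implicit.
Unset Printing Implicit Defensive.

Local Notation Re := complex.Re.
Local Notation Im := complex.Im.

(** Why the theorem holds.

    If [h] and [k] differ, some point [w] of the circle has two distinct
    preimages, one under [h] and one under [k]. A nonnegative function [u]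
    carried by a short arc at [w] is then pulled back to two nonnegative
    functions [f = u \o h] and [g = u \o k] whose supports stay apart. Such
    functions have a nonpositive inner product: it is, up to a positive factor,
    minus the double integral of [f x * g y / sin ((x - y) / 2) ^ 2]. Hence
      [|V_h u - V_k u|^2 >= |V_h u|^2 + |V_k u|^2 >= (m(V_h)^2 + m(V_k)^2) |u|^2]
    with no error term ([seminorm_separated]).

    To see that a compact perturbation [K] does not help, take unit vectors
    [u_0, u_1, ...] of this kind on disjoint arcs. The same sign, now for the
    inner products of the [u_i], gives [|u_{i_1} + ... + u_{i_m}|^2 <= m], and
    this alone forces [K u_i] to come arbitrarily close to zero
    ([compact_operator_almost_orthogonal]).

    The sign of the inner product is proved without any completeness of the
    trigonometric system. The Abel means
    [sum_n n r^n (f^(n) conj(g^(n)) + its conjugate)] open up, by linearity of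
    the integral, into the double integral of [f x * g y] against
    [Re (z / (1 - z)^2)], [z = r e^{i(x - y)}]. That kernel has the sign of
    [(1 + r^2) cos (x - y) - 2 r], which is negative when [cos (x - y)] is
    bounded away from [1] and [r] is close to [1] ([kernel_le],
    [cross_terms_near], [sum_le_of_abel]).

    The test functions are [z |-> max (0, Re (z conj w) - cos a)]: their Fourier
    coefficients decay like [n^-2], so they are in the space, and they are
    continuous, so their precise representatives are the functions themselves
    and [V_h] is composition with [h] on them. The remaining claims are soft:
    [m(T) = |T^-1|^-1] in any nonzero normed space, and discreteness at [V_h] holds with
    radius [m(V_h) > 0]. *)

(** * Norms with values in the reals *)

Section real_norm.
Context {R : realType} {E : normedModType R[i]}.
Implicit Types (x y : E).

Definition rnorm x : R := Re `|x|.

Lemma rnormE x : `|x| = (rnorm x)%:C%C.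
Proof.
have : 0 <= `|x| by [].
by rewrite /rnorm; case: `|x| => a b; rewrite lecE /= => /andP[/eqP -> _].
Qed.

Lemma rnorm_ge0 x : 0 <= rnorm x.
Proof. by rewrite -lecR -rnormE; exact: normr_ge0. Qed.

Lemma rnormD x y : rnorm (x + y) <= rnorm x + rnorm y.
Proof. by have := ler_normD x y; rewrite !rnormE -rmorphD lecR. Qed.

Lemma rnormZ (a : R) x : rnorm (a%:C%C *: x) = `|a| * rnorm x.
Proof.
have := normrZ (a%:C%C) x; rewrite !rnormE normc_def /= expr0n addr0 sqrtr_sqr.
by rewrite -rmorphM => /complexI.
Qed.

Lemma rnormN x : rnorm (- x) = rnorm x.
Proof. by rewrite /rnorm normrN. Qed.

Lemma rnormB x y : rnorm (x - y) = rnorm (y - x).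
Proof. by rewrite -rnormN opprB. Qed.

Lemma rnorm0 : rnorm (0 : E) = 0.
Proof. by rewrite /rnorm normr0. Qed.

Lemma rnorm_gt0 x : x != 0 -> 0 < rnorm x.
Proof. by rewrite -normr_gt0 rnormE ltcR. Qed.

Lemma rnorm_normalized x : x != 0 -> rnorm ((rnorm x)^-1%:C%C *: x) = 1.
Proof.
move=> /rnorm_gt0 x0.
by rewrite rnormZ ger0_norm ?invr_ge0 ?ltW// mulVf// gt_eqF.
Qed.

Lemma rnorm_le1 x : (`|x| <= 1) = (rnorm x <= 1).
Proof. by rewrite rnormE -lecR. Qed.

Lemma rnorm_eq1 x : (`|x| = 1) <-> (rnorm x = 1).
Proof. by rewrite rnormE; split=> [/complexI|->]. Qed.

Lemma rnorm_near (y : E) (e : R) : 0 < e -> \forall x \near y, rnorm (y - x) < e.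
Proof.
move=> e0; have : nbhs y (ball y e%:C%C) by apply: nbhsx_ballx; rewrite ltcR.
apply: filterS => x; rewrite -ball_normE /ball_ /=.
by rewrite rnormE ltcR.
Qed.

End real_norm.

(** * Operator norm, minimum modulus and compact operators *)

Section operator_facts.
Context {R : realType} {E : normedModType R[i]}.
Implicit Types (T S K : {linear E -> E}) (x y : E).

Lemma rnorm_linear_normalized T x :
  rnorm (T ((rnorm x)^-1%:C%C *: x)) = rnorm (T x) / rnorm x.
Proof.
by rewrite linearZ rnormZ ger0_norm ?invr_ge0 ?rnorm_ge0// mulrC.
Qed.

Lemma linear_bounded_rnorm T : continuous T ->
  exists2 C : R, 0 < C & forall x, rnorm (T x) <= C * rnorm x.
Proof.
move=> /linear_bounded_continuous/linear_boundedP[M [Mr MT]].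
have rM : `|Re M| + 1 > Re M by rewrite ltr_pwDr// ler_norm.
exists (`|Re M| + 1); first by rewrite ltr_wpDl.
move=> x; rewrite -lecR rmorphM /= -!rnormE; apply: MT.
move: Mr rM; case: (M) => a b; rewrite complex_real /= => /eqP -> rM.
by rewrite ltcR.
Qed.

(** Compactness turns the pointwise bound [rnorm y < n], valid near each [y],
    into a bound valid on the whole image of the unit ball. *)
Lemma compact_operator_bounded K : compact_operator K ->
  exists2 C : R, 0 < C & forall x, rnorm (K x) <= C * rnorm x.
Proof.
move=> /compact_near_coveringP cK.
have [N _ HN] : \forall n \near \oo,
    closure (K @` [set x | `|x| <= 1]) `<=` [set y | rnorm y <= n%:R].
  apply: (cK _ \oo (fun (n : nat) y => rnorm y <= n%:R)) => y _.
  have ny : \forall y' \near y & n \near \oo,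
      rnorm (y - y') < 1 /\ rnorm y + 1 <= n%:R.
    exists ([set y' | rnorm (y - y') < 1], [set n : nat | rnorm y + 1 <= n%:R]).
      split; first exact: rnorm_near.
      exact: nbhs_infty_ger.
    by case=> y' n [].
  apply: filterS ny => -[y' n] /= [yy' yn].
  have := rnormD y (y' - y); rewrite addrC subrK rnormB; lra.
have H1 x : rnorm x = 1 -> rnorm (K x) <= N%:R.
  move=> x1; apply: (HN N (leqnn N)); apply: subset_closure.
  by exists x => //=; rewrite rnorm_le1 x1.
exists (N%:R + 1); first by rewrite ltr_wpDl.
move=> x; have [->|x0] := eqVneq x 0; first by rewrite linear0 !rnorm0 mulr0.
rewrite -ler_pdivrMr ?rnorm_gt0// -rnorm_linear_normalized.
by apply: le_trans (H1 _ (rnorm_normalized x0)) _; rewrite lerDl.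
Qed.

Lemma rnorm_sum (I : eqType) (s : seq I) (F : I -> E) (c : R) :
  (forall i, i \in s -> rnorm (F i) <= c) ->
  rnorm (\sum_(i <- s) F i) <= (size s)%:R * c.
Proof.
elim: s => [_|i s IH Hs]; first by rewrite big_nil rnorm0 mul0r.
rewrite big_cons /= -nat1r mulrDl mul1r.
apply: le_trans (rnormD _ _) _; rewrite lerD ?Hs ?mem_head ?IH// => j js.
by rewrite Hs// in_cons js orbT.
Qed.

(** A compact operator cannot stay away from zero along an almost orthogonal
    sequence: infinitely many [K (x i)] would lie close to a single vector [y]
    far from zero, so that the averages of the corresponding [x i], which tend
    to zero like the inverse square root of their number, would have images
    that stay close to [y]. *)
Lemma compact_operator_almost_orthogonal K (x : nat -> E) :
  compact_operator K -> (forall i, rnorm (x i) <= 1) ->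
  (forall s, uniq s -> rnorm (\sum_(i <- s) x i) ^+ 2 <= (size s)%:R) ->
  forall e : R, 0 < e -> exists i, rnorm (K (x i)) < e.
Proof.
move=> cK x1 xs e e0; apply: contrapT => /forallNP He.
have {}He i : e <= rnorm (K (x i)) by have /negP := He i; rewrite -leNgt.
have [C C0 HC] := compact_operator_bounded cK.
have [y [_ yc]] : closure (K @` [set x | `|x| <= 1]) `&`
    cluster ((K \o x) @ \oo) !=set0.
  apply: cK; exists 0%N => // n _ /=; apply: subset_closure.
  by exists (x n) => //=; rewrite rnorm_le1.
have often N : exists2 i, (N <= i)%N & rnorm (y - K (x i)) < e / 4.
  have [] := yc (K @` (x @` [set i | (N <= i)%N])) [set z | rnorm (y - z) < e / 4].
  - by exists N => // i /= Ni; exists (x i) => //; exists i.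
  - by apply: rnorm_near; rewrite divr_gt0.
  - by move=> _ [[_ [i Ni <-] <-]] /= H; exists i.
have many (m : nat) : exists s : seq nat, [/\ uniq s, size s = m &
    forall i, i \in s -> rnorm (y - K (x i)) < e / 4].
  elim: m => [|m [s [us sm ys]]]; first by exists [::].
  have [i ni yi] := often (\max_(j <- s) j).+1.
  exists (i :: s); split => /=; last 2 first.
  - by rewrite sm.
  - by move=> j; rewrite in_cons => /orP[/eqP->//|]; exact: ys.
  rewrite us andbT; apply/negP => iss.
  by have := @leq_bigmax_seq _ s xpredT id i iss erefl; rewrite leqNgt ni.
have y34 : 3 * e / 4 <= rnorm y.
  have [i _ yi] := often 0%N; have := rnormD (K (x i) - y) y.
  rewrite subrK rnormB => yK; have := He i; lra.
(* [n] exceeds the value at which the lower bound [n * e / 2] for the image of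
   the sum of [n] terms meets the upper bound [C * sqrt n]. *)
have [n Hn] : exists n : nat, (C / (e / 2)) ^+ 2 < n%:R.
  by exists (Num.truncn ((C / (e / 2)) ^+ 2)).+1; rewrite Num.Theory.truncnS_gt.
have n0 : 0 < n%:R :> R by apply: le_lt_trans Hn; exact: sqr_ge0.
have [s [us sn ys]] := many n.
have S1 : rnorm (\sum_(i <- s) (y - K (x i))) <= n%:R * (e / 4).
  rewrite -sn; apply: rnorm_sum => i Hi; exact/ltW/ys.
have S2 : n%:R * rnorm y <= n%:R * (e / 4) + rnorm (K (\sum_(i <- s) x i)).
  have <- : rnorm (\sum_(i <- s) y) = n%:R * rnorm y.
    rewrite big_const_seq count_predT sn iter_addr_0 -scaler_nat.
    have -> : (n%:R : R[i]) = (n%:R : R)%:C%C by rewrite rmorph_nat.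
    by rewrite rnormZ ger0_norm.
  have -> : \sum_(i <- s) y = \sum_(i <- s) (y - K (x i)) + K (\sum_(i <- s) x i).
    by rewrite linear_sum -big_split /=; apply: eq_bigr => i _; rewrite subrK.
  by apply: le_trans (rnormD _ _) _; rewrite lerD2r.
have S3 := HC (\sum_(i <- s) x i).
have S4 := xs _ us; rewrite sn in S4.
have S5 : n%:R * (e / 2) <= C * rnorm (\sum_(i <- s) x i) by nra.
set r := rnorm _ in S4 S5.
have r0 : 0 <= r := rnorm_ge0 _.
have S6 : n%:R <= C / (e / 2) * r.
  by rewrite mulrAC ler_pdivlMr// divr_gt0.
have : n%:R ^+ 2 <= (C / (e / 2)) ^+ 2 * n%:R.
  apply: (@le_trans _ _ ((C / (e / 2) * r) ^+ 2)).
    by rewrite lerXn2r ?nnegrE ?ler0n// (le_trans _ S6) ?ler0n.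
  by rewrite exprMn ler_wpM2l ?sqr_ge0.
by rewrite expr2 ler_pM2r// leNgt Hn.
Qed.

Lemma op_norm_ub (T : E -> E) (C : R) x :
  (forall z, rnorm (T z) <= C * rnorm z) -> 0 <= C -> rnorm x <= 1 ->
  rnorm (T x) <= op_norm T.
Proof.
move=> HC C0 x1; apply: ub_le_sup; last by exists x => //=; rewrite rnorm_le1.
exists C => _ [z /= + <-]; rewrite rnorm_le1 => z1.
by apply: le_trans (HC z) _; rewrite ler_piMr.
Qed.

Lemma op_norm_le (T : E -> E) (C : R) :
  (forall z, rnorm z <= 1 -> rnorm (T z) <= C) -> op_norm T <= C.
Proof.
move=> HC; apply: ge_sup; first by exists (rnorm (T 0)), 0 => //=; rewrite normr0.
by move=> _ [z /= + <-]; rewrite rnorm_le1; exact: HC.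
Qed.

Lemma min_modulus_le T x : min_modulus T * rnorm x <= rnorm (T x).
Proof.
have [->|x0] := eqVneq x 0; first by rewrite linear0 !rnorm0 mulr0.
rewrite -ler_pdivlMr ?rnorm_gt0// -rnorm_linear_normalized.
apply: ge_inf; first by exists 0 => _ [z _ <-]; exact: rnorm_ge0.
by exists ((rnorm x)^-1%:C%C *: x) => //=; exact/rnorm_eq1/rnorm_normalized.
Qed.

Lemma min_modulus_ge0 T : 0 <= min_modulus T.
Proof.
rewrite /min_modulus; set S := [set _ | _ in _].
have [->|/set0P S0] := eqVneq S set0; first by rewrite inf0.
by apply: lb_le_inf => // _ [z _ <-]; exact: rnorm_ge0.
Qed.

Lemma min_modulus_ge T (c : R) : (exists x : E, rnorm x = 1) ->
  (forall x, rnorm x = 1 -> c <= rnorm (T x)) -> c <= min_modulus T.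
Proof.
move=> [x /rnorm_eq1 x1] H; apply: lb_le_inf; first by exists (rnorm (T x)), x.
by move=> _ [z /= /rnorm_eq1 z1 <-]; exact: H.
Qed.

(** The two bounds come from [|x| = |S (T x)| <= |S| |T x|] and
    [m(T) |S z| <= |T (S z)| = |z|]. In the zero space the infimum would be that
    of the empty set. *)
Lemma min_modulus_inverse T S : continuous S -> inverse_operator T S ->
  (exists x : E, rnorm x = 1) ->
  0 < min_modulus T /\ min_modulus T = (op_norm S)^-1.
Proof.
move=> /linear_bounded_rnorm[C C0 HC] [TS ST] [x0 x01].
have Sle x : rnorm (S x) <= op_norm S * rnorm x.
  have [->|nx0] := eqVneq x 0; first by rewrite linear0 !rnorm0 mulr0.
  rewrite -ler_pdivrMr ?rnorm_gt0// -rnorm_linear_normalized.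
  by apply: (op_norm_ub HC (ltW C0)); rewrite rnorm_normalized.
have S0 : 0 < op_norm S.
  have := Sle (T x0); rewrite TS x01 => H.
  have op0 : 0 <= op_norm S.
    by apply: le_trans (op_norm_ub HC (ltW C0) (x := 0) _); rewrite ?rnorm_ge0// rnorm0.
  rewrite lt_neqAle op0 andbT; apply/eqP => Z; move: H; rewrite -Z mul0r; lra.
have mS : (op_norm S)^-1 <= min_modulus T.
  apply: min_modulus_ge; first by exists x0.
  move=> x x1; rewrite -[leLHS]mul1r ler_pdivrMr// mulrC -x1 -{1}(TS x).
  exact: Sle.
have m0 : 0 < min_modulus T by apply: lt_le_trans mS; rewrite invr_gt0.
split => //; apply/eqP; rewrite eq_le mS andbT -[leLHS]invrK lef_pV2 ?posrE ?invr_gt0//.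
apply: op_norm_le => z z1; rewrite -[leRHS]mul1r ler_pdivlMr//.
apply: le_trans z1; rewrite mulrC -[in leRHS](ST z); exact: min_modulus_le.
Qed.

Lemma compact_operator0 : compact_operator (\0 : {linear E -> E}).
Proof.
rewrite /compact_operator.
have -> : (\0 : {linear E -> E}) @` [set x | `|x| <= 1] = [set 0].
  apply/seteqP; split => [_ [x _ <-]//|_ ->].
  by exists 0 => //=; rewrite normr0.
rewrite -(iffLR (closure_id [set (0 : E)])); first exact: compact_set1.
by apply/accessible_closed_set1/hausdorff_accessible/norm_hausdorff.
Qed.

Lemma ess_norm_ge (T : E -> E) (c : R) :
  (forall K, compact_operator K -> c <= op_norm (T \- K)) -> c <= ess_norm T.
Proof.
move=> H; apply: lb_le_inf; last by move=> _ [K cK <-]; exact: H.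
by exists (op_norm (T \- \0)), \0 => //; exact: compact_operator0.
Qed.

Lemma continuous_sub_linear T S : continuous T -> continuous S ->
  continuous (T \- S).
Proof. by move=> cT cS x; apply: cvgB; [exact: cT|exact: cS]. Qed.

(** A lower bound along an almost orthogonal sequence of unit vectors survives
    every compact perturbation, which is small somewhere along the sequence. *)
Lemma op_norm_ge_sequence T K (x : nat -> E) (c : R) :
  continuous T -> compact_operator K -> (forall i, rnorm (x i) = 1) ->
  (forall s, uniq s -> rnorm (\sum_(i <- s) x i) ^+ 2 <= (size s)%:R) ->
  (forall i, c <= rnorm (T (x i))) -> c <= op_norm (T \- K).
Proof.
move=> /linear_bounded_rnorm[C C0 HC] cK x1 xs Tc.
have [D D0 HD] := compact_operator_bounded cK.
apply/ler_addgt0Pr => e e0.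
have [|i Ki] := compact_operator_almost_orthogonal cK _ xs e0.
  by move=> i; rewrite x1.
apply: (@le_trans _ _ (rnorm ((T \- K) (x i)) + e)); last first.
  rewrite lerD2r; apply: (@op_norm_ub _ (C + D)); rewrite ?x1//; last first.
    by rewrite addr_ge0 ?ltW.
  move=> z /=; apply: le_trans (rnormD _ _) _; rewrite rnormN mulrDl.
  exact: lerD.
have := rnormD (T (x i) - K (x i)) (K (x i)); rewrite subrK => H.
have := Tc i; rewrite /=; lra.
Qed.

End operator_facts.

(** * The kernel of the Abel means of the inner product *)

Section kernel.
Context {R : realType}.
Implicit Types (r s t c x e : R) (M N n : nat).

(** The partial sums of [Re (z / (1 - z)^2)], [z = r e^{it}]. As [r] tends to
    one, they become, up to a factor, the Fourier series of the distribution that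
    represents the inner product of the space. *)
Definition kernel r M t : R := \sum_(n < M.+1) n%:R * r ^+ n * cos (n%:R * t).

Lemma cos_recurrence x t : cos (x + t) = 2 * cos t * cos x - cos (x - t).
Proof. by rewrite cosD cosB; ring. Qed.

Let remainder r M t : R :=
  M%:R * r * (cos ((M%:R + 2) * t) - 2 * r * cos ((M%:R + 1) * t)
              + r ^+ 2 * cos (M%:R * t))
  - (M%:R + 1) * (cos ((M%:R + 1) * t) - 2 * r * cos (M%:R * t)
              + r ^+ 2 * cos ((M%:R - 1) * t)).

(** The real part of
      [(1 - z)^2 (z + 2 z^2 + ... + M z^M) = z - (M + 1) z^(M + 1) + M z^(M + 2)]
    after multiplication by [(1 - conj z)^2]. The induction only uses the
    three-term recurrence of the cosines. *)
Lemma kernelE r M t :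
  (1 - 2 * r * cos t + r ^+ 2) ^+ 2 * kernel r M t =
  r * ((1 + r ^+ 2) * cos t - 2 * r) + r ^+ M.+1 * remainder r M t.
Proof.
rewrite /kernel; elim: M => [|M IH].
  rewrite big_ord_recl big_ord0 /remainder /= !add0r !mul1r mulN1r cosN !mul0r cos0.
  by ring.
rewrite big_ord_recr /= mulrDr {}IH -addrA; congr (_ + _).
rewrite /remainder -(natr1 M) (exprS r M.+1) (exprS r M).
set m : R := M%:R.
have e3 : cos ((m + 1 + 2) * t) = 2 * cos t * cos ((m + 2) * t) - cos ((m + 1) * t).
  rewrite (_ : (m + 1 + 2) * t = (m + 2) * t + t); last by ring.
  by rewrite cos_recurrence; congr (_ - cos _); ring.
have e2 : cos ((m + 2) * t) = 2 * cos t * cos ((m + 1) * t) - cos (m * t).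
  rewrite (_ : (m + 2) * t = (m + 1) * t + t); last by ring.
  by rewrite cos_recurrence; congr (_ - cos _); ring.
have e1 : cos ((m - 1) * t) = 2 * cos t * cos (m * t) - cos ((m + 1) * t).
  rewrite (_ : (m + 1) * t = m * t + t); last by ring.
  rewrite cos_recurrence (_ : (m - 1) * t = m * t - t); last by ring.
  by ring.
rewrite (_ : m + 1 + 1 = m + 2); last by ring.
rewrite (_ : m + 1 - 1 = m); last by ring.
by rewrite e3 e2 e1; ring.
Qed.

Lemma natmul_exp_le s n : 0 <= s -> s <= 1 -> n%:R * s ^+ n * (1 - s) <= 1 - s ^+ n.
Proof.
move=> s0 s1; elim: n => [|n IH]; first by rewrite !mul0r subr_ge0 expr0.
rewrite -natr1 exprS.
have p0 : 0 <= s ^+ n by rewrite exprn_ge0.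
have p1 : s ^+ n <= 1 by rewrite exprn_ile1.
set p := s ^+ n in IH p0 p1 *; set m := n%:R in IH *.
have H1 : s * (m * p * (1 - s)) <= s * (1 - p) by rewrite ler_wpM2l.
have H2 : s * p * (1 - s) <= 1 - s by rewrite ler_piMl ?subr_ge0// mulr_ile1.
nra.
Qed.

(** With [s = sqrt r], [n r^n] is [s^n] times [n s^n], and the latter is bounded
    by [1 / (1 - s)]. *)
Lemma cvg_natmul_exp r : 0 <= r -> r < 1 -> n%:R * r ^+ n @[n --> \oo] --> (0 : R).
Proof.
move=> r0 r1; set s := Num.sqrt r.
have s0 : 0 <= s by exact: sqrtr_ge0.
have s1 : s < 1 by rewrite -sqrtr1 ltr_sqrt.
apply: (@squeeze_cvgr _ _ _ _ (fun=> 0) (fun n => (1 - s)^-1 * s ^+ n)).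
- near=> n; rewrite mulr_ge0 ?exprn_ge0//=.
  have -> : r ^+ n = s ^+ n * s ^+ n by rewrite -exprMn -expr2 sqr_sqrtr.
  rewrite mulrA ler_wpM2r ?exprn_ge0// -[leRHS]mul1r ler_pdivlMr ?subr_gt0//.
  apply: le_trans (natmul_exp_le n s0 (ltW s1)) _.
  by rewrite gerBl exprn_ge0.
- exact: cvg_cst.
- rewrite -[X in _ --> X](mulr0 (1 - s)^-1); apply: cvgMr.
  by apply: cvg_expr; rewrite ger0_norm.
Unshelve. all: by end_near. Qed.

(** The full sum [Re (z / (1 - z)^2)] has the sign of [(1 + r^2) cos t - 2 r],
    so the partial sums are nonpositive up to the truncation error, which is
    [O (M r^M)] uniformly in [t]. *)
Lemma kernel_le r c e : 0 < r < 1 -> (1 + r ^+ 2) * c <= 2 * r -> 0 < e ->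
  \forall M \near \oo, forall t, cos t <= c -> kernel r M t <= e.
Proof.
move=> /andP[r0 r1] rc e0.
(* The bracketed cosines in the remainder are at most 4 in absolute value, which
   gives 4 M + 4 (M + 1) <= 12 M; and 1 - 2 r cos t + r^2 >= (1 - r)^2. *)
pose b M : R := r * 12 / (1 - r) ^+ 4 * (M%:R * r ^+ M).
have cb : b M @[M --> \oo] --> (0 : R).
  rewrite -[X in _ --> X](mulr0 (r * 12 / (1 - r) ^+ 4)); apply: cvgMr.
  exact: (cvg_natmul_exp (ltW r0) r1).
near=> M => t tc.
have be : b M < e by near: M; exact: (cvgr_lt _ cb).
have M1 : 1 <= M%:R :> R by rewrite ler1n; near: M; exact: nbhs_infty_gt.
apply: le_trans (ltW be).
have D0 : (1 - r) ^+ 2 <= 1 - 2 * r * cos t + r ^+ 2.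
  have := cos_le1 t; nra.
have d0 : 0 < (1 - r) ^+ 2 by rewrite exprn_gt0// subr_gt0.
set D := 1 - 2 * r * cos t + r ^+ 2 in D0.
have P : `|remainder r M t| <= M%:R * 4 + (M%:R + 1) * 4.
  have q x y z : `|x| <= 1 -> `|y| <= 1 -> `|z| <= 1 ->
      `|x - 2 * r * y + r ^+ 2 * z| <= 4.
    rewrite !ler_norml => /andP[? ?] /andP[? ?] /andP[? ?]; apply/andP; split; nra.
  rewrite /remainder; apply: le_trans (ler_normB _ _) _; apply: lerD.
    rewrite normrM ler_pM ?q ?cos_max// normrM !ger0_norm ?(ltW r0)//.
    by rewrite ler_piMr// (ltW r1).
  by rewrite normrM ler_pM ?q ?cos_max// ger0_norm// addr_ge0.
have K : D ^+ 2 * kernel r M t <= r * r ^+ M * (12 * M%:R).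
  rewrite kernelE (exprS r M) -[leRHS]add0r; apply: lerD.
    rewrite mulr_ge0_le0 ?(ltW r0)// subr_le0 (le_trans _ rc)//.
    by rewrite ler_wpM2l// addr_ge0 ?sqr_ge0.
  rewrite ler_wpM2l ?mulr_ge0 ?exprn_ge0 ?(ltW r0)//.
  apply: le_trans (ler_norm _) _; apply: le_trans P _; lra.
have [k0|k0] := leP (kernel r M t) 0.
  apply: (le_trans k0); rewrite /b; do ?[apply: mulr_ge0] => //; rewrite ?ltW//.
    by rewrite invr_gt0 exprn_gt0// subr_gt0.
  by rewrite exprn_gt0.
rewrite /b mulrAC ler_pdivlMr ?exprn_gt0 ?subr_gt0//.
apply: (@le_trans _ _ (D ^+ 2 * kernel r M t)).
  rewrite mulrC ler_wpM2r ?(ltW k0)// (_ : (1 - r) ^+ 4 = ((1 - r) ^+ 2) ^+ 2); last by rewrite -exprM.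
  by rewrite lerXn2r ?nnegrE ?(ltW d0)// (le_trans _ D0) ?(ltW d0).
apply: le_trans K _; rewrite [leLHS](_ : _ = r * 12 * (M%:R * r ^+ M)) //; ring.
Unshelve. all: by end_near. Qed.

(** The first [N] terms already contribute at least [r^N] times their sum to the
    Abel means; then [r] tends to one. *)
Lemma sum_le_of_abel (x : nat -> R) (B r0 : R) : (forall n, 0 <= x n) -> r0 < 1 ->
  (forall r e, r0 < r -> 0 < r < 1 -> 0 < e ->
     \forall M \near \oo, \sum_(n < M.+1) r ^+ n * x n <= B + e) ->
  forall N, \sum_(n < N) x n <= B.
Proof.
move=> x0 r01 H N.
have S0 : 0 <= \sum_(n < N) x n by rewrite sumr_ge0.
set S := \sum_(n < N) x n in S0 *.
have SB r : r0 < r -> 0 < r < 1 -> r ^+ N * S <= B.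
  move=> rr0 r01'; apply/ler_addgt0Pr => e e0.
  have [M [+ NM]] : exists M, \sum_(n < M.+1) r ^+ n * x n <= B + e /\ (N <= M)%N.
    have [M1 _ HM1] := H r e rr0 r01' e0.
    exists (maxn M1 N); split; last exact: leq_maxr.
    by apply: HM1 => /=; exact: leq_maxl.
  apply: le_trans.
  have /andP[rp rl] := r01'.
  rewrite -(big_mkord xpredT (fun n => r ^+ n * x n)) (big_cat_nat (n := N))//=; last exact: leqW.
  rewrite -[leLHS]addr0 lerD//; last first.
    by apply: sumr_ge0 => n _; rewrite mulr_ge0// exprn_ge0// ltW.
  rewrite big_mkord mulr_sumr; apply: ler_sum => n _.
  by rewrite ler_wpM2r// ler_wiXn2l ?(ltW rp) ?(ltW rl)// ltnW.
have cr : r ^+ N * S @[r --> (1 : R)^'-] --> 1 ^+ N * S.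
  by apply: cvgMl; apply: cvg_at_left_filter; exact: exprn_continuous.
rewrite expr1n mul1r in cr.
apply: (cvgr_to_le cr); near=> r; apply: SB; first by near: r; exact: nbhs_left_gt.
by apply/andP; split; near: r; [exact: nbhs_left_gt|exact: nbhs_left_lt].
Unshelve. all: by end_near. Qed.

End kernel.

(** * Cross terms of functions with separated supports *)

Section cross_terms.
Context {R : realType}.
Local Notation mu := (@lebesgue_measure R).
Local Notation circ := (`[0, 2 * pi]%classic : set R).
Implicit Types (f g : R -> R) (r s t c x e : R) (M N n : nat).

Local Notation L1 f := (mu.-integrable circ (EFin \o f)).

Definition cosc f n : R := \int[mu]_(t in circ) (f t * cos (n%:R * t)).
Definition sinc f n : R := \int[mu]_(t in circ) (f t * sin (n%:R * t)).

Let mcirc : measurable circ. Proof. exact: measurable_itv. Qed.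

Lemma integrable_mul_continuous f (k : R -> R) :
  continuous k -> (forall t, `|k t| <= 1) -> L1 f -> L1 (fun t => f t * k t).
Proof.
move=> ck k1 fi; apply: integrable_mulb => //; last exact: bounded_circ.
apply: subspace_continuous_measurable_fun => //.
exact: continuous_subspaceT.
Qed.

Lemma continuous_cosZ n : continuous (fun t : R => cos (n%:R * t)).
Proof.
by move=> t; apply: continuous_comp; [apply: cvgMr; exact: cvg_id|exact: continuous_cos].
Qed.

Lemma continuous_sinZ n : continuous (fun t : R => sin (n%:R * t)).
Proof.
by move=> t; apply: continuous_comp; [apply: cvgMr; exact: cvg_id|exact: continuous_sin].
Qed.

Lemma integrable_cosZ f n : L1 f -> L1 (fun t => f t * cos (n%:R * t)).
Proof.
by apply: integrable_mul_continuous; [exact: continuous_cosZ|move=> t; exact: cos_max].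
Qed.

Lemma integrable_sinZ f n : L1 f -> L1 (fun t => f t * sin (n%:R * t)).
Proof.
by apply: integrable_mul_continuous; [exact: continuous_sinZ|move=> t; exact: sin_max].
Qed.

Lemma Rintegral_sum (F : nat -> R -> R) N : (forall n, L1 (F n)) ->
  L1 (fun t => \sum_(n < N) F n t) /\
  \int[mu]_(t in circ) (\sum_(n < N) F n t) = \sum_(n < N) \int[mu]_(t in circ) F n t.
Proof.
move=> iF; elim: N => [|N [IH1 IH2]].
  under [X in EFin \o X]funext do rewrite big_ord0.
  split; first exact: integrable0.
  rewrite big_ord0; under eq_Rintegral do rewrite big_ord0.
  by rewrite Rintegral_cst// mul0r.
split.
  under [X in EFin \o X]funext do rewrite big_ord_recr.
  have := @integrableD _ _ _ mu circ mcirc _ _ IH1 (iF N).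
  by apply: eq_integrable.
rewrite big_ord_recr /= -IH2 -RintegralD//.
by apply: eq_Rintegral => t _; rewrite big_ord_recr.
Qed.

(** Points [e^{is}], [e^{it}] of the two supports are at distance at least some
    [d > 0]: the squared distance is [2 - 2 cos (s - t)], so that [c] is
    [1 - d^2 / 2]. *)
Definition separated_supports f g := exists2 c : R, c < 1 &
  forall s t, circ s -> circ t -> f s != 0 -> g t != 0 -> cos (s - t) <= c.

(** By linearity of the integral the sum on the left is the double integral of
    [f s * g t * kernel r M (s - t)]; wherever the factor [f s * g t] is nonzero
    the kernel is at most [e]. *)
Lemma cross_terms_le f g r c e M : (forall t, cos t <= c -> kernel r M t <= e) ->
  L1 f -> L1 g -> (forall t, 0 <= f t) -> (forall t, 0 <= g t) ->
  (forall s t, circ s -> circ t -> f s != 0 -> g t != 0 -> cos (s - t) <= c) ->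
  \sum_(n < M.+1) r ^+ n * (n%:R * (cosc f n * cosc g n + sinc f n * sinc g n)) <=
  e * (\int[mu]_(t in circ) f t * \int[mu]_(t in circ) g t).
Proof.
move=> ker fi gi f0 g0 fg.
pose G s := \sum_(n < M.+1) (r ^+ n * n%:R) *
  (cosc g n * cos (n%:R * s) + sinc g n * sin (n%:R * s)).
have iF n : L1 (fun s => (r ^+ n * n%:R) * cosc g n * (f s * cos (n%:R * s))
      + (r ^+ n * n%:R) * sinc g n * (f s * sin (n%:R * s))).
  by apply: integrable_lin => //; [exact: integrable_cosZ|exact: integrable_sinZ].
have [ifG fG] := Rintegral_sum M.+1 iF.
have -> : \sum_(n < M.+1) r ^+ n * (n%:R * (cosc f n * cosc g n + sinc f n * sinc g n))
    = \int[mu]_(s in circ) (f s * G s).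
  transitivity (\int[mu]_(s in circ) \sum_(n < M.+1)
      ((r ^+ n * n%:R) * cosc g n * (f s * cos (n%:R * s))
      + (r ^+ n * n%:R) * sinc g n * (f s * sin (n%:R * s)))).
    rewrite fG; apply: eq_bigr => n _.
    rewrite Rintegral_lin//; [|exact: integrable_cosZ|exact: integrable_sinZ].
    by rewrite /cosc /sinc; ring.
  apply: eq_Rintegral => s _; rewrite /G mulr_sumr; apply: eq_bigr => n _; ring.
have ifG' : L1 (fun s => f s * G s).
  move: ifG; apply: eq_integrable => // s _ /=; congr EFin.
  rewrite /G mulr_sumr; apply: eq_bigr => n _; ring.
have iH s n : L1 (fun t => (r ^+ n * n%:R) * cos (n%:R * s) * (g t * cos (n%:R * t))
    + (r ^+ n * n%:R) * sin (n%:R * s) * (g t * sin (n%:R * t))).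
  by apply: integrable_lin => //; [exact: integrable_cosZ|exact: integrable_sinZ].
have GE s : G s = \int[mu]_(t in circ) (g t * kernel r M (s - t)).
  transitivity (\int[mu]_(t in circ) \sum_(n < M.+1)
      ((r ^+ n * n%:R) * cos (n%:R * s) * (g t * cos (n%:R * t))
      + (r ^+ n * n%:R) * sin (n%:R * s) * (g t * sin (n%:R * t)))).
    rewrite (Rintegral_sum M.+1 (iH s)).2; apply: eq_bigr => n _.
    rewrite Rintegral_lin//; [|exact: integrable_cosZ|exact: integrable_sinZ].
    by rewrite -/(cosc g n) -/(sinc g n); ring.
  apply: eq_Rintegral => t _; rewrite /kernel mulr_sumr; apply: eq_bigr => n _.
  by rewrite mulrBr cosB; ring.
have iK s : L1 (fun t => g t * kernel r M (s - t)).
  have := (Rintegral_sum M.+1 (iH s)).1.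
  apply: eq_integrable => // t _ /=; congr EFin; rewrite /kernel mulr_sumr.
  by apply: eq_bigr => n _; rewrite mulrBr cosB; ring.
have iZ a k : L1 k -> L1 (fun t => a * k t).
  move=> ki; rewrite (_ : EFin \o _ = (fun t => a%:E * (EFin \o k) t)%E)//.
  exact: integrableZl.
set J := \int[mu]_(t in circ) g t.
rewrite [leRHS](_ : _ = e * J * \int[mu]_(t in circ) f t); last by rewrite -mulrA [J * _]mulrC.
rewrite -RintegralZl//.
apply: le_Rintegral => //; first exact: iZ.
- move=> s cs; have [->|fs] := eqVneq (f s) 0; first by rewrite mul0r mulr0.
  rewrite mulrC ler_wpM2r// GE /J -RintegralZl//.
  apply: le_Rintegral => //; first exact: iZ.
  move=> t ct; have [->|gt] := eqVneq (g t) 0; first by rewrite mul0r mulr0.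
  by rewrite mulrC ler_wpM2r// ker// fg.
Qed.

(** The radius [r0] is such that [(1 + r^2) c <= 2 r] beyond it, so that the kernel
    is small enough, in the limit of large [M], to absorb the two integrals. *)
Lemma cross_terms_near f g : L1 f -> L1 g ->
  (forall t, 0 <= f t) -> (forall t, 0 <= g t) -> separated_supports f g ->
  exists2 r0, r0 < 1 & forall r e, r0 < r -> 0 < r < 1 -> 0 < e ->
    \forall M \near \oo,
    \sum_(n < M.+1) r ^+ n * (n%:R * (cosc f n * cosc g n + sinc f n * sinc g n)) <= e.
Proof.
move=> fi gi f0 g0 [c c1 fg].
pose I := \int[mu]_(t in circ) f t * \int[mu]_(t in circ) g t.
have I0 : 0 <= I by rewrite mulr_ge0// Rintegral_ge0.
have cr : (1 + r ^+ 2) * c - 2 * r @[r --> (1 : R)^'-] --> (1 + 1 ^+ 2) * c - 2 * 1.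
  apply: cvgB; last by apply: cvgMr; exact: cvg_at_left_filter.
  apply: cvgMl; apply: cvgD; first exact: cvg_cst.
  by apply: cvg_at_left_filter; exact: exprn_continuous.
have [r0 r01 Hr0] : exists2 r0 : R, r0 < 1 &
    forall r, r0 < r -> r < 1 -> (1 + r ^+ 2) * c <= 2 * r.
  have : \forall r \near (1 : R)^'-, (1 + r ^+ 2) * c - 2 * r < 0.
    by apply: (cvgr_lt _ cr); rewrite expr1n; lra.
  move=> [d /= d0 Hd]; exists (1 - d); first by rewrite gtrBl.
  move=> r rd r1; rewrite -subr_le0 ltW//; apply: Hd => //=.
  by rewrite ltr_distlC; apply/andP; split; lra.
exists r0 => // r e rr0 /andP[rp r1] e0.
have e' : 0 < e / (I + 1) by rewrite divr_gt0// ltr_wpDl.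
have Ke := kernel_le (r := r) (c := c) _ (Hr0 r rr0 r1) e'.
near=> M.
apply: (@le_trans _ _ (e / (I + 1) * I)).
  apply: (@cross_terms_le _ _ _ c) => //; near: M; apply: Ke.
  by rewrite rp.
rewrite mulrAC ler_pdivrMr ?ltr_wpDl// ler_pM2l//; lra.
Unshelve. all: by end_near. Qed.

End cross_terms.

(** * The norm of a real function through its cosine and sine integrals *)

Section int_sums.
Context {R : realType}.
Implicit Types (a : nat -> R) (B : R).

Lemma esum_int_abs a : (forall n, 0 <= a n) ->
  (\esum_(n in [set n : int | n != 0%R]) (a `|n|%N)%:E =
   \sum_(k <oo) (a k.+1)%:E + \sum_(k <oo) (a k.+1)%:E)%E.
Proof.
move=> a0; rewrite (esumID [set n : int | 0 < n]); last by move=> n _; rewrite lee_fin.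
congr (_ + _)%E.
- rewrite nneseries_esumT; last by move=> k; rewrite lee_fin.
  apply: (reindex_esum _ _ (fun k : nat => Posz k.+1)); split => //.
    by move=> j k _ _ [].
  by move=> [[|n]|n] //= [_ //= _]; exists n.
- rewrite nneseries_esumT; last by move=> k; rewrite lee_fin.
  apply: (reindex_esum _ _ (fun k : nat => Negz k)); split => //.
    by move=> j k _ _ [].
  by move=> [[|n]|n] //= [//= _ _]; exists n.
Qed.

Lemma esum_int_abs_leP a B : (forall n, 0 <= a n) -> a 0%N = 0 ->
  (\esum_(n in [set n : int | n != 0%R]) (a `|n|%N)%:E <= B%:E)%E <->
  forall N, 2 * \sum_(n < N) a n <= B.
Proof.
move=> a0 a00; rewrite esum_int_abs//.
have aE n : (0 <= (a n.+1)%:E)%E by rewrite lee_fin.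
have shift N : \sum_(n < N.+1) a n = \sum_(k < N) a k.+1.
  by rewrite big_ord_recl a00 add0r.
have fin N : (\sum_(0 <= k < N) (a k.+1)%:E)%E = (\sum_(k < N) a k.+1)%:E.
  by rewrite sumEFin big_mkord.
split=> [H N|H].
  apply: (@le_trans _ _ (2 * \sum_(n < N.+1) a n)).
    by rewrite ler_pM2l// big_ord_recr/= lerDl.
  rewrite shift -lee_fin; apply: le_trans H; rewrite mulr_natl mulr2n EFinD -fin.
  by rewrite leeD// nneseries_lim_ge.
have half : (\sum_(k <oo) (a k.+1)%:E <= (B / 2)%:E)%E.
  apply: lime_le; first exact: is_cvg_nneseries.
  by apply: nearW => N; rewrite fin lee_fin ler_pdivlMr// mulrC -shift.
by apply: le_trans (leeD half half) _; rewrite -EFinD lee_fin -splitr.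
Qed.

End int_sums.

Section half_order_real.
Context {R : realType}.
Local Notation C := R[i].
Local Notation S1 := (unit_circle R).
Local Notation circ := (`[0, 2 * pi]%classic : set R).
Implicit Types (u v : HalfFun R) (f g : R -> R).

Definition profile (u : S1 -> C) (t : R) : R := Re (u (expi t)).

(** For the profile [f] of a real function this is the contribution of each of the
    frequencies [n] and [- n] to the squared norm. *)
Definition energy f n : R :=
  n%:R * ((2 * pi)^-1 ^+ 2 * (cosc f n ^+ 2 + sinc f n ^+ 2)).

Lemma energy_ge0 f n : 0 <= energy f n.
Proof. by rewrite mulr_ge0// mulr_ge0 ?addr_ge0 ?sqr_ge0. Qed.

Lemma energy0 f : energy f 0 = 0. Proof. by rewrite /energy mul0r. Qed.

Lemma natr_absz_cos (n : int) (t : R) : cos (n%:~R * t) = cos (`|n|%:R * t).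
Proof. by case: n => n //; rewrite NegzE /= mulrNz mulNr cosN. Qed.

Lemma fourier_real (u : S1 -> C) n : (forall z, Im (u z) = 0) ->
  cintegrable circ (u \o expi) ->
  normc (fourier u n) ^+ 2 =
  (2 * pi)^-1 ^+ 2 * (cosc (profile u) `|n| ^+ 2 + sinc (profile u) `|n| ^+ 2).
Proof.
move=> ur [iu _]; rewrite /fourier normcM exprMn; congr (_ * _).
  by rewrite /= expr0n addr0 sqr_sqrtr ?sqr_ge0.
rewrite /cint /= sqr_sqrtr ?addr_ge0 ?sqr_ge0//; congr (_ + _).
  congr (_ ^+ 2); apply: eq_Rintegral => t _.
  rewrite /profile; have := ur (expi t); case: (u (expi t)) => x y /= ->.
  by rewrite mul0r subr0 cosN natr_absz_cos.
have [e e1 He] : exists2 e : R, e ^+ 2 = 1 & forall t,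
    sin (- (n%:~R * t)) = e * sin (`|n|%:R * t).
  case: n => n; [exists (-1)|exists 1].
  - by rewrite sqrrN expr1n.
  - by move=> t; rewrite sinN mulN1r.
  - by rewrite expr1n.
  - by move=> t; rewrite NegzE /= mulrNz mulNr opprK mul1r.
transitivity ((\int[lebesgue_measure]_(t in circ) (e * (profile u t * sin (`|n|%:R * t)))) ^+ 2).
  congr (_ ^+ 2); apply: eq_Rintegral => t _.
  rewrite /profile; have := ur (expi t); case: (u (expi t)) => x y /= ->.
  by rewrite mul0r addr0 He mulrCA.
rewrite RintegralZl//; last exact: integrable_sinZ.
by rewrite exprMn e1 mul1r.
Qed.

Lemma integrable_profile u : (@lebesgue_measure R).-integrable circ (EFin \o profile u).
Proof. by have [] := HalfFun_cintegrable u. Qed.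

Lemma Hhalf_sqr_leP (u : S1 -> C) B : (forall z, Im (u z) = 0) ->
  cintegrable circ (u \o expi) ->
  (Hhalf_sqr u <= B%:E)%E <-> forall N, 2 * \sum_(n < N) energy (profile u) n <= B.
Proof.
move=> ur iu; rewrite -(esum_int_abs_leP _ (energy_ge0 _) (energy0 _)).
rewrite [X in (X <= _)%E](_ : _ = \esum_(n in [set n : int | n != 0%R])
  (energy (profile u) `|n|)%:E)//.
apply: eq_esum => n _; by rewrite fourier_real.
Qed.

Lemma energy_le u N : (forall z, Im (u z) = 0) ->
  2 * \sum_(n < N) energy (profile u) n <= Hhalf_seminorm u ^+ 2.
Proof.
move=> ur; move: N; apply/Hhalf_sqr_leP => //; first exact: HalfFun_cintegrable.
by rewrite Hhalf_seminormK.
Qed.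

Lemma seminorm_le u B : (forall z, Im (u z) = 0) ->
  (forall N, 2 * \sum_(n < N) energy (profile u) n <= B) ->
  Hhalf_seminorm u ^+ 2 <= B.
Proof.
move=> ur /Hhalf_sqr_leP; rewrite Hhalf_seminormK lee_fin; apply => //.
exact: HalfFun_cintegrable.
Qed.

Lemma energyD f g s n :
  (@lebesgue_measure R).-integrable circ (EFin \o f) ->
  (@lebesgue_measure R).-integrable circ (EFin \o g) -> s ^+ 2 = 1 ->
  energy (fun t => f t + s * g t) n = energy f n + energy g n +
  2 * s * (2 * pi)^-1 ^+ 2 * (n%:R * (cosc f n * cosc g n + sinc f n * sinc g n)).
Proof.
move=> fi gi s1.
have Ec : cosc (fun t => f t + s * g t) n = cosc f n + s * cosc g n.
  rewrite /cosc -[in RHS](mul1r (Rintegral _ _ _)) -Rintegral_lin//; last 2 first.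
  - exact: integrable_cosZ.
  - exact: integrable_cosZ.
  by apply: eq_Rintegral => t _; ring.
have Es : sinc (fun t => f t + s * g t) n = sinc f n + s * sinc g n.
  rewrite /sinc -[in RHS](mul1r (Rintegral _ _ _)) -Rintegral_lin//; last 2 first.
  - exact: integrable_sinZ.
  - exact: integrable_sinZ.
  by apply: eq_Rintegral => t _; ring.
rewrite /energy Ec Es !sqrrD !exprMn s1; ring.
Qed.

Lemma nonneg_real (u : S1 -> C) : (forall z, 0 <= u z) -> forall z, Im (u z) = 0.
Proof. by move=> u0 z; have := u0 z; rewrite lecE /= => /andP[/eqP]. Qed.

Lemma profile_ge0 (u : S1 -> C) : (forall z, 0 <= u z) -> forall t, 0 <= profile u t.
Proof. by move=> u0 t; have := u0 (expi t); rewrite lecE /= => /andP[]. Qed.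

Lemma profileD u v : profile (u + v) = (fun t => profile u t + 1 * profile v t).
Proof.
apply/funext => t; rewrite mul1r /profile.
have -> : (u + v) (expi t) = u (expi t) + v (expi t) by [].
by case: (u _) (v _) => [? ?] [? ?].
Qed.

Lemma profileB u v : profile (u - v) = (fun t => profile u t + (-1) * profile v t).
Proof.
apply/funext => t; rewrite mulN1r /profile.
have -> : (u - v) (expi t) = u (expi t) - v (expi t) by [].
by case: (u _) (v _) => [? ?] [? ?].
Qed.

(** Both inequalities say that nonnegative functions with separated supports have
    a nonpositive inner product. The inner product itself is never formed: only
    its Abel means are compared with the norms, and the limit is taken on sums of
    nonnegative terms. *)
Lemma seminorm_separated u v : (forall z, 0 <= u z) -> (forall z, 0 <= v z) ->
  separated_supports (profile u) (profile v) ->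
  Hhalf_seminorm (u + v) ^+ 2 <= Hhalf_seminorm u ^+ 2 + Hhalf_seminorm v ^+ 2 /\
  Hhalf_seminorm u ^+ 2 + Hhalf_seminorm v ^+ 2 <= Hhalf_seminorm (u - v) ^+ 2.
Proof.
move=> u0 v0 uv.
have ur := nonneg_real u0; have vr := nonneg_real v0.
have uDr z : Im ((u + v) z) = 0.
  have -> : (u + v) z = u z + v z by [].
  by have := ur z; have := vr z; case: (u z) (v z) => [? ?] [? ?] /= -> ->; rewrite addr0.
have uBr z : Im ((u - v) z) = 0.
  have -> : (u - v) z = u z - v z by [].
  by have := ur z; have := vr z; case: (u z) (v z) => [? ?] [? ?] /= -> ->; rewrite subr0.
have ui := integrable_profile u; have vi := integrable_profile v.
have [r0 r01 Hr0] := cross_terms_near ui vi (profile_ge0 u0) (profile_ge0 v0) uv.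
set k : R := (2 * pi)^-1 ^+ 2.
have k0 : 0 < k by rewrite exprn_gt0// invr_gt0 mulr_gt0// pi_gt0.
pose X r M : R := \sum_(n < M.+1) r ^+ n * (n%:R *
  (cosc (profile u) n * cosc (profile v) n + sinc (profile u) n * sinc (profile v) n)).
have abel (w : HalfFun R) r M : 0 < r < 1 -> (forall z, Im (w z) = 0) ->
    \sum_(n < M.+1) r ^+ n * (2 * energy (profile w) n) <= Hhalf_seminorm w ^+ 2.
  move=> /andP[rp r1] wr; apply: le_trans (energy_le M.+1 wr).
  rewrite mulr_sumr; apply: ler_sum => n _.
  apply: ler_piMl; first by rewrite mulr_ge0 ?energy_ge0.
  by apply: exprn_ile1; exact: ltW.
have split_sum (w : HalfFun R) s r M : s ^+ 2 = 1 ->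
    profile w = (fun t => profile u t + s * profile v t) ->
    \sum_(n < M.+1) r ^+ n * (2 * energy (profile w) n) =
    \sum_(n < M.+1) r ^+ n * (2 * energy (profile u) n) +
    \sum_(n < M.+1) r ^+ n * (2 * energy (profile v) n) + 4 * s * k * X r M.
  move=> s1 ->; rewrite /X mulr_sumr -!big_split /=; apply: eq_bigr => n _.
  by rewrite energyD// /k; ring.
have near4 r e : r0 < r -> 0 < r < 1 -> 0 < e ->
    \forall M \near \oo, 4 * k * X r M <= e.
  move=> rr0 r01' e0; have k4 : 0 < 4 * k by rewrite mulr_gt0.
  have e4 : 0 < e / (4 * k) by rewrite divr_gt0.
  apply: filterS (Hr0 r _ rr0 r01' e4) => M.
  by rewrite ler_pdivlMr// [X in X <= _ -> _]mulrC.
split.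
- apply: seminorm_le => // N; rewrite mulr_sumr.
  apply: (sum_le_of_abel (x := fun n => 2 * energy (profile (u + v)) n) _ r01).
    by move=> n; rewrite mulr_ge0 ?energy_ge0.
  move=> r e rr0 r01' e0; apply: filterS (near4 r e rr0 r01' e0) => M HM.
  rewrite (split_sum _ 1 r M _ (profileD u v)) ?expr1n// mulr1.
  by rewrite lerD// lerD// abel.
- have main N : \sum_(n < N) (2 * energy (profile u) n + 2 * energy (profile v) n) <=
      Hhalf_seminorm (u - v) ^+ 2.
    apply: (sum_le_of_abel (x := fun n => 2 * energy (profile u) n + 2 * energy (profile v) n) _ r01).
      by move=> n; rewrite addr_ge0// mulr_ge0 ?energy_ge0.
    move=> r e rr0 r01' e0; apply: filterS (near4 r e rr0 r01' e0) => M HM.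
    under eq_bigr do rewrite mulrDr.
    rewrite big_split /=; have := abel _ r M r01' uBr.
    rewrite (split_sum _ (-1) r M _ (profileB u v)) ?sqrrN ?expr1n//.
    by move: HM; lra.
  have mono (w : HalfFun R) N P : (N <= P)%N ->
      2 * \sum_(n < N) energy (profile w) n <= 2 * \sum_(n < P) energy (profile w) n.
    move=> NP; rewrite ler_pM2l// -2!(big_mkord xpredT (energy (profile w))).
    by rewrite (big_cat_nat (n := N) (p := P))//= lerDl sumr_ge0// => n _; exact: energy_ge0.
  rewrite -lerBrDr; apply: seminorm_le => // N.
  rewrite lerBrDr addrC -lerBrDr; apply: seminorm_le => // P.
  rewrite lerBrDr; apply: le_trans (main (maxn N P)); rewrite big_split /= -!mulr_sumr.
  by rewrite addrC lerD// mono// ?leq_maxl// leq_maxr.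
Qed.

End half_order_real.

(** * Bumps: compactly supported test functions *)

Section bumps.
Context {R : realType}.
Local Notation C := R[i].
Local Notation S1 := (unit_circle R).
Local Notation mu := (@lebesgue_measure R).
Local Notation circ := (`[0, 2 * pi]%classic : set R).
Implicit Types (t s x y : R) (z : S1).

Section bump.
Variables (q a : R).
Hypotheses (a0 : 0 < a) (api : a <= pi / 2) (qa : a <= q) (aq : q <= 2 * pi - a).

(** At [e^{it}] this is the positive part of [cos (t - q) - cos a], carried by
    the arc of half-width [a] centred at [q]; the hypotheses keep that arc inside
    the interval of integration [[0, 2 pi]]. *)
Definition arc_bump z : C^o :=
  (Num.max 0 (Re (val z) * cos q + Im (val z) * sin q - cos a))%:C%C.

Let w t := cos (t - q) - cos a.
Local Notation arc := (`[q - a, q + a]%classic : set R).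

Lemma bump_ge0 z : 0 <= arc_bump z.
Proof. by rewrite /arc_bump lecR le_max lexx. Qed.

Lemma profile_bump t : profile arc_bump t = Num.max 0 (w t).
Proof. by rewrite /profile /arc_bump /w cosB. Qed.

Lemma continuous_profile_bump : continuous (profile arc_bump).
Proof.
have -> : profile arc_bump = fun t => Num.max 0 (w t) by apply/funext => t; exact: profile_bump.
move=> t; apply: continuous_max; first exact: cvg_cst.
apply: cvgB; last exact: cvg_cst.
apply: continuous_comp; last exact: continuous_cos.
by apply: cvgB; [exact: cvg_id|exact: cvg_cst].
Qed.

Let api' : a <= pi. Proof. by have := @pi_gt0 R; move: api; lra. Qed.

Let cosle x y : 0 <= x -> x <= y -> y <= pi -> cos y <= cos x.
Proof.
move=> x0 xy ypi; rewrite leNgt ltr_cos ?in_itv /= -?leNgt//; apply/andP; split => //.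
- exact: le_trans x0 xy.
- exact: le_trans xy ypi.
Qed.

Lemma bump_in t : `|t - q| <= a -> 0 <= w t.
Proof. by move=> tq; rewrite subr_ge0 -(cos_norm (t - q)) cosle. Qed.

Lemma bump_out t : circ t -> w t > 0 -> `|t - q| < a.
Proof.
rewrite /= in_itv /= => /andP[t0 t2]; rewrite subr_gt0 -(cos_norm (t - q)).
rewrite ltNge => H; rewrite ltNge; apply: contra H => aq'.
have xle : `|t - q| <= 2 * pi - a.
  by rewrite ler_norml; apply/andP; split; move: qa aq; lra.
have [xpi|xpi] := leP `|t - q| pi; first by rewrite cosle// ltW.
have -> : cos `|t - q| = cos (2 * pi - `|t - q|).
  by rewrite -cosN -[in LHS](cosD2pi (- `|t - q|)) addrC mulr_natl.
by apply: cosle; [exact: ltW|lra|lra].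
Qed.

Lemma bump_support t : circ t -> profile arc_bump t != 0 -> `|t - q| < a.
Proof.
move=> ct; rewrite profile_bump => H; apply: bump_out => //.
by rewrite ltNge; apply: contra H => /max_idPl ->.
Qed.

Let arc_circ : circ `&` arc = arc.
Proof.
apply/seteqP; split => [t []//|t]; rewrite /= !in_itv /= => /andP[H1 H2].
by split; apply/andP; split; move: qa aq; lra.
Qed.

Let arcP t : arc t <-> `|t - q| <= a.
Proof. by rewrite /= in_itv /= ler_norml; split=> /andP[? ?]; apply/andP; split; lra. Qed.

Lemma Rintegral_bump (k : R -> R) :
  \int[mu]_(t in circ) (profile arc_bump t * k t) = \int[mu]_(t in arc) (w t * k t).
Proof.
rewrite -[in RHS]arc_circ Rintegral_mkcondr; apply: eq_Rintegral => t /set_mem ct.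
rewrite patchE profile_bump; case: ifPn => [/set_mem/arcP/bump_in w0|].
  by rewrite (max_idPr w0).
rewrite notin_setE => /arcP H; rewrite (max_idPl _) ?mul0r//.
by rewrite leNgt; apply/negP => /(bump_out ct)/ltW.
Qed.

Let w_arc_ends : w (q - a) = 0 /\ w (q + a) = 0.
Proof.
rewrite /w; split; apply/eqP; rewrite subr_eq0; apply/eqP.
  by rewrite addrAC subrr add0r cosN.
by rewrite addrAC subrr add0r.
Qed.

Let continuous_cos_affine (b : R) x : continuous (fun t : R => cos (b * t - x)).
Proof.
move=> t; apply: continuous_comp; last exact: continuous_cos.
by apply: cvgB; [apply: cvgMr; exact: cvg_id|exact: cvg_cst].
Qed.

Let integrable_arc (k : R -> R) : continuous k -> mu.-integrable arc (EFin \o k).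
Proof.
move=> ck; apply: continuous_compact_integrable; first exact: segment_compact.
exact: continuous_subspaceT.
Qed.

Let cw : continuous w.
Proof.
move=> t; apply: cvgB; last exact: cvg_cst.
apply: continuous_comp; last exact: continuous_cos.
by apply: cvgB; [exact: cvg_id|exact: cvg_cst].
Qed.

(** Two integrations by parts on the arc, where the bump is smooth; it vanishes
    at the endpoints, so that only its derivative contributes there, at the order
    [n^-2]. *)
Lemma bump_coefficient_le n x : (0 < n)%N ->
  `|\int[mu]_(t in arc) (w t * cos (n%:R * t - x))| <= 6 / n%:R ^+ 2.
Proof.
move=> n0; have n0' : n%:R != 0 :> R by rewrite pnatr_eq0 -lt0n.
(* [E] is the boundary term of the two integrations by parts. *)
pose E t : R := w t * sin (n%:R * t - x) / n%:R - sin (t - q) * cos (n%:R * t - x) / n%:R ^+ 2.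
pose e t : R := w t * cos (n%:R * t - x) - cos (t - q) * cos (n%:R * t - x) / n%:R ^+ 2.
have dE t : is_derive t 1 E (e t).
  rewrite /E /w; apply: is_derive_eq; rewrite /e /w.
  by rewrite /GRing.scale /=; field.
have ec : continuous e.
  move=> t; apply: cvgB.
    by apply: cvgM; [exact: cw|exact: continuous_cos_affine].
  apply: cvgMl; apply: cvgM; last exact: continuous_cos_affine.
  apply: continuous_comp; last exact: continuous_cos.
  by apply: cvgB; [exact: cvg_id|exact: cvg_cst].
have Ec : continuous E.
  by move=> t; apply/differentiable_continuous/derivable1_diffP; case: (dE t).
have FTC : \int[mu]_(t in arc) e t = E (q + a) - E (q - a).
  rewrite /Rintegral (@continuous_FTC2 _ e E) //; first by move: a0; lra.
  - exact: continuous_subspaceT.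
  - split; last 2 first.
    + exact/cvg_at_right_filter/Ec.
    + exact/cvg_at_left_filter/Ec.
    by move=> t _; case: (dE t).
  - by move=> t _; rewrite derive1E; case: (dE t).
have [wl wr] := w_arc_ends.
have ccos : continuous (fun t => cos (t - q) * cos (n%:R * t - x)).
  move=> t; apply: cvgM; last exact: continuous_cos_affine.
  apply: continuous_comp; last exact: continuous_cos.
  by apply: cvgB; [exact: cvg_id|exact: cvg_cst].
pose J := \int[mu]_(t in arc) (cos (t - q) * cos (n%:R * t - x)).
have IJ : \int[mu]_(t in arc) (w t * cos (n%:R * t - x)) =
    E (q + a) - E (q - a) + J / n%:R ^+ 2.
  rewrite -FTC; transitivity (1 * (\int[mu]_(t in arc) e t) + (n%:R ^+ 2)^-1 * J); last first.
    by rewrite mul1r [J / _]mulrC.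
  rewrite /J -Rintegral_lin//; last 2 first.
  - exact: integrable_arc.
  - exact: integrable_arc.
  by apply: eq_Rintegral => t _; rewrite /e; ring.
have J4 : `|J| <= 4.
  apply: le_trans (le_normr_Rintegral _ _) _ => //; first exact: integrable_arc.
  apply: (@le_trans _ _ (\int[mu]_(t in arc) 1)).
    apply: le_Rintegral => //.
    - by apply: integrable_arc => t; apply: cvg_norm; exact: ccos.
    - by apply: integrable_arc => t; exact: cvg_cst.
    - by move=> t _; rewrite normrM mulr_ile1// cos_max.
  rewrite Rintegral_cst//= mul1r lebesgue_measure_itv /= lte_fin.
  rewrite ifT; last by move: a0; lra.
  rewrite -EFinB /=; move: api (@pihalf_lt2 R); lra.
rewrite IJ /E wl wr !mul0r !sub0r.
set X := sin (q + a - q) * cos (n%:R * (q + a) - x).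
set Y := sin (q - a - q) * cos (n%:R * (q - a) - x).
rewrite (_ : _ + _ = (J - X + Y) / n%:R ^+ 2); last by ring.
have bX : `|X| <= 1 by rewrite normrM mulr_ile1// ?sin_max ?cos_max.
have bY : `|Y| <= 1 by rewrite normrM mulr_ile1// ?sin_max ?cos_max.
rewrite normrM [X in _ * X]ger0_norm ?invr_ge0 ?sqr_ge0// ler_wpM2r ?invr_ge0 ?sqr_ge0//.
by move: J4 bX bY; rewrite !ler_norml => /andP[? ?] /andP[? ?] /andP[? ?]; apply/andP; split; lra.
Qed.

Lemma energy_bump_le n : energy (profile arc_bump) n <= 72 * (n%:R^-1) ^+ 2.
Proof.
have [->|n0] := posnP n; first by rewrite energy0 mulr_ge0// sqr_ge0.
have n1 : 1 <= n%:R :> R by rewrite ler1n.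
have npos : 0 < n%:R :> R by rewrite ltr0n.
have c6 : `|cosc (profile arc_bump) n| <= 6 / n%:R ^+ 2.
  rewrite /cosc Rintegral_bump; have := bump_coefficient_le 0 n0.
  by under eq_Rintegral do rewrite subr0.
have s6 : `|sinc (profile arc_bump) n| <= 6 / n%:R ^+ 2.
  rewrite /sinc Rintegral_bump; have := bump_coefficient_le (pi / 2) n0.
  by under eq_Rintegral do rewrite cosBpihalf.
have q6 x : `|x| <= 6 / n%:R ^+ 2 -> x ^+ 2 <= 36 * (n%:R^-1) ^+ 4.
  move=> H; rewrite -real_normK ?num_real//.
  rewrite (_ : 36 * _ = (6 / n%:R ^+ 2) ^+ 2); last by rewrite -exprVn; ring.
  by rewrite lerXn2r ?nnegrE// mulr_ge0// invr_ge0 sqr_ge0.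
have i1 : n%:R^-1 <= 1 :> R by rewrite invf_le1.
have i0 : 0 < n%:R^-1 :> R by rewrite invr_gt0.
have k1 : (2 * pi)^-1 ^+ 2 <= 1 :> R.
  rewrite exprn_ile1 ?invr_ge0 ?mulr_ge0 ?pi_ge0// invf_le1 ?mulr_gt0 ?pi_gt0//.
  by move: (@pi_ge2 R); lra.
have S : cosc (profile arc_bump) n ^+ 2 + sinc (profile arc_bump) n ^+ 2 <= 72 * (n%:R^-1) ^+ 4.
  by have := q6 _ c6; have := q6 _ s6; lra.
have S0 : 0 <= cosc (profile arc_bump) n ^+ 2 + sinc (profile arc_bump) n ^+ 2.
  by rewrite addr_ge0 ?sqr_ge0.
rewrite /energy; apply: (@le_trans _ _ (n%:R * (72 * (n%:R^-1) ^+ 4))).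
  rewrite ler_pM2l//; apply: le_trans S.
  by rewrite ler_piMl.
rewrite (_ : n%:R * _ = 72 * n%:R^-1 ^+ 2 * n%:R^-1); last by field; rewrite gt_eqF.
by rewrite ler_piMr// mulr_ge0// sqr_ge0.
Qed.

Let sum_inv_sqr N : \sum_(n < N.+1) (n%:R^-1) ^+ 2 <= 2 - N%:R^-1 :> R.
Proof.
elim: N => [|N IH]; first by rewrite big_ord_recr big_ord0 /= invr0 expr0n /=; lra.
rewrite big_ord_recr /=; have [->|N0] := posnP N.
  by rewrite big_ord_recr big_ord0 /= invr0 expr0n invr1 expr1n /=; lra.
apply: le_trans (lerD IH (lexx _)) _.
have Np : 0 < N%:R :> R by rewrite ltr0n.
rewrite -subr_ge0 -(natr1 N) (_ : _ - _ = (N%:R * (N%:R + 1) ^+ 2)^-1); last first.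
  by field; rewrite !gt_eqF// ltr_wpDl// ltW.
by rewrite invr_ge0 mulr_ge0 ?sqr_ge0// ltW.
Qed.

Lemma bump_mem : arc_bump \in @Hhalf_pred R.
Proof.
have br z : Im (arc_bump z) = 0 by [].
have bi : cintegrable circ (arc_bump \o expi).
  split.
    apply: continuous_compact_integrable; first exact: segment_compact.
    exact/continuous_subspaceT/continuous_profile_bump.
  exact: integrable0.
apply/asboolP; split => //; apply: (@le_lt_trans _ _ (288%:E)); last exact: ltry.
apply/Hhalf_sqr_leP => // N; apply: (@le_trans _ _ (2 * \sum_(n < N.+1) 72 * (n%:R^-1) ^+ 2)).
  rewrite ler_pM2l// big_ord_recr /=; apply: (@le_trans _ _ (\sum_(n < N) 72 * (n%:R^-1) ^+ 2)).
    by apply: ler_sum => n _; exact: energy_bump_le.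
  by rewrite lerDl mulr_ge0// sqr_ge0.
rewrite -mulr_sumr; have := sum_inv_sqr N; have : 0 <= N%:R^-1 :> R by rewrite invr_ge0.
lra.
Qed.

Definition bump_fun : HalfFun R := MkHalfFun bump_mem.

Let inner := (`[q - a / 2, q + a / 2]%classic : set R).

(** The integrand is nonnegative, and on the inner half of the arc it is bounded
    below by a positive constant. *)
Let bump_moment_gt0 : 0 < \int[mu]_(t in arc) (w t * cos (t - q)).
Proof.
pose m := cos (a / 2) - cos a.
have m0 : 0 < m.
  rewrite subr_gt0 ltr_cos ?in_itv /=; last 2 first.
  - by apply/andP; split; move: api' a0; lra.
  - by apply/andP; split; move: api' a0; lra.
  by move: a0; lra.
have ca : 0 <= cos a by apply: cos_ge0_pihalf; apply/andP; split; move: a0 api (@pi_gt0 R); lra.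
have innerP t : inner t -> m <= w t /\ m <= cos (t - q).
  rewrite /inner /= in_itv /= => /andP[t1 t2].
  have tq : `|t - q| <= a / 2 by rewrite ler_norml; apply/andP; split; lra.
  have : cos (a / 2) <= cos (t - q).
    by rewrite -(cos_norm (t - q)) cosle//; move: api' a0; lra.
  by rewrite /m /w; move: ca; lra.
have inner_arc : arc `&` inner = inner.
  apply/seteqP; split => [t []//|t]; rewrite /inner /= !in_itv /= => /andP[H1 H2].
  by split; apply/andP; split; move: a0; lra.
apply: (@lt_le_trans _ _ (\int[mu]_(t in arc `&` inner) (m ^+ 2))).
  rewrite inner_arc /inner Rintegral_cst//= lebesgue_measure_itv/= lte_fin.
  rewrite ifT; last by move: a0; lra.
  by rewrite mulr_gt0 ?exprn_gt0// -EFinB /=; move: a0; lra.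
rewrite Rintegral_mkcondr; apply: le_Rintegral => //.
- have -> : EFin \o ((fun=> m ^+ 2) \_ inner) = (EFin \o (fun=> m ^+ 2)) \_ inner.
    by apply/funext => t /=; rewrite !patchE; case: ifP.
  apply/integrable_restrict => //; first exact: measurable_itv.
  rewrite inner_arc.
  have : mu.-integrable arc (EFin \o (fun=> m ^+ 2)).
    by apply: integrable_arc => t; exact: cvg_cst.
  by apply: integrableS => //; [exact: measurable_itv|rewrite -inner_arc => t []].
- apply: integrable_arc => t; apply: cvgM; first exact: cw.
  apply: continuous_comp; last exact: continuous_cos.
  by apply: cvgB; [exact: cvg_id|exact: cvg_cst].
- move=> t /arcP ta; rewrite patchE; case: ifPn => [/set_mem/innerP[mw mc]|_].
    by rewrite expr2 ler_pM// ltW.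
  rewrite mulr_ge0 ?bump_in// -(cos_norm (t - q)).
  apply: cos_ge0_pihalf; apply/andP; split; last exact: le_trans ta api.
  by apply: le_trans (normr_ge0 _); rewrite oppr_le0 divr_ge0// pi_ge0.
Qed.

(** The first Fourier coefficient, rotated by [e^{iq}], has a positive real
    part. *)
Lemma bump_fun_seminorm_gt0 : 0 < Hhalf_seminorm bump_fun.
Proof.
rewrite lt_neqAle Hhalf_seminorm_ge0 andbT; apply/eqP => n0.
have := @energy_le R bump_fun 2 (fun=> erefl).
rewrite -n0 expr0n /= !big_ord_recr big_ord0 /= energy0 !add0r /energy mul1r => H.
have k0 : 0 < 2 * (2 * pi)^-1 ^+ 2 :> R.
  by rewrite mulr_gt0// exprn_gt0// invr_gt0 mulr_gt0// pi_gt0.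
move: H; rewrite mulrA pmulr_rle0// => H.
have [c0 s0] : cosc (profile arc_bump) 1 = 0 /\ sinc (profile arc_bump) 1 = 0.
  by have := sqr_ge0 (cosc (profile arc_bump) 1); have := sqr_ge0 (sinc (profile arc_bump) 1);
    move: H; split; apply/eqP; rewrite -sqrf_eq0; apply/eqP; lra.
have := bump_moment_gt0.
rewrite -(Rintegral_bump (fun t => cos (t - q))).
rewrite (_ : Rintegral _ _ _ = cos q * cosc (profile arc_bump) 1 + sin q * sinc (profile arc_bump) 1).
  by rewrite c0 s0 !mulr0 addr0 ltxx.
have bi := integrable_profile bump_fun.
rewrite -Rintegral_lin//; [|exact: integrable_cosZ|exact: integrable_sinZ].
by apply: eq_Rintegral => t _; rewrite mul1r cosB; ring.
Qed.

End bump.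
End bumps.

(** * The circle and precise representatives *)

Section circle_facts.
Context {R : realType}.
Local Notation C := R[i].
Local Notation S1 := (unit_circle R).
Local Notation mu := (@lebesgue_measure R).
Local Notation circ := (`[0, 2 * pi]%classic : set R).
Implicit Types (t s x y : R) (z : S1).

Lemma circle_eq (z1 z2 : S1) : val z1 = val z2 -> z1 = z2.
Proof. exact: val_inj. Qed.

Lemma circle_expi z : exists2 t : R, 0 <= t < 2 * pi & z = expi t.
Proof.
have : (Re (val z)) ^+ 2 + (Im (val z)) ^+ 2 = 1.
  have := set_mem (valP z); rewrite /unit_circle /= normc_def => -[] /(congr1 (fun x => x ^+ 2)).
  by rewrite sqr_sqrtr ?addr_ge0 ?sqr_ge0// expr1n.
set a := Re _; set b := Im _ => ab.
have zE : val z = (a +i* b)%C by rewrite /a /b; case: (val z).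
have a1 : -1 <= a <= 1.
  by apply/andP; split; have := sqr_ge0 b; nra.
have [b0|b0] := leP 0 b.
  exists (acos a).
    rewrite acos_ge0//=; apply: le_lt_trans (acos_lepi a1) _.
    by rewrite ltr_pMl ?pi_gt0// ltr1n.
  apply: circle_eq; rewrite zE /= acosK ?in_itv// sin_acos//.
  by rewrite -ab addrAC subrr add0r sqrtr_sqr ger0_norm.
have a1' : a < 1.
  by rewrite lt_neqAle (andP a1).2 andbT; apply/eqP => a_1; move: ab b0; rewrite a_1; nra.
exists (- acos a + pi *+ 2).
  have := acos_gt0 (x := a); rewrite (andP a1).1 a1' => /(_ erefl) p0.
  have := acos_lepi a1; have := @pi_gt0 R; rewrite -mulr_natl => ? ?.
  by apply/andP; split; lra.
apply: circle_eq; rewrite zE /= cosD2pi sinD2pi cosN sinN acosK ?in_itv// sin_acos//.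
by rewrite -ab addrAC subrr add0r sqrtr_sqr ltr0_norm// opprK.
Qed.

Lemma rot_expi s t : Defs.rot (expi s) t = expi (s + t).
Proof. by apply: circle_eq => /=; simpc; rewrite cosD sinD; congr (_ +i* _)%C; ring. Qed.

(** Averages over shrinking arcs of a continuous function converge to its
    value. *)
Lemma precise_continuous (u : S1 -> C) z : (forall z, Im (u z) = 0) ->
  continuous (profile u) -> precise u z = u z.
Proof.
move=> ur cu; have [s _ ->] := circle_expi z.
pose g t := profile u (s + t).
have cg : continuous g.
  move=> t; apply: continuous_comp; last exact: cu.
  by apply: cvgD; [exact: cvg_cst|exact: cvg_id].
have gi (x y : R) : mu.-integrable `[x, y] (EFin \o g).
  apply: continuous_compact_integrable; first exact: segment_compact.
  exact: continuous_subspaceT.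
have uE t : u (Defs.rot (expi s) t) = (g t)%:C%C.
  by rewrite rot_expi /g /profile; have := ur (expi (s + t)); case: (u _) => ? ? /= ->.
have gO r : \int[mu]_(t in `[- r, r]) g t = \int[mu]_(t in ball 0 r) g t.
  rewrite ball_itv sub0r add0r -Rintegral_itv_bndo_bndc -?Rintegral_itv_obnd_cbnd//.
    by apply: integrableS (gi (- r) r) => //; exact: subset_itv_oo_cc.
  by apply: integrableS (gi (- r) r) => //; exact: subset_itv_co_cc.
have mE r : mean u (expi s) r = ((r *+ 2)^-1 * \int[mu]_(t in ball 0 r) g t)%:C%C.
  rewrite /mean /cint -gO mulr_natl.
  under [X in (X +i* _)%C]eq_Rintegral do rewrite uE /=.
  under [X in (_ +i* X)%C]eq_Rintegral do rewrite uE /=.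
  by rewrite Rintegral_cst// mul0r; simpc.
have {}mE : mean u (expi s) = fun r => ((r *+ 2)^-1 * \int[mu]_(t in ball 0 r) g t)%:C%C.
  exact/funext.
rewrite /precise mE.
have -> : u (expi s) = (g 0)%:C%C.
  by rewrite /g addr0 /profile; have := ur (expi s); case: (u _) => ? ? /= ->.
rewrite /=; congr (_ +i* _)%C; last by apply: cvg_lim; [exact: Rhausdorff|exact: cvg_cst].
apply: cvg_lim; first exact: Rhausdorff.
have iA : mu.-integrable (ball 0 1) (EFin \o g).
  by rewrite ball_itv; apply: integrableS (gi (0 - 1) (0 + 1)) => //; exact: subset_itv_oo_cc.
have := @lebesgue_differentiation_continuous R g (ball 0 1) 0 (ball_open _ _) iA (cg 0).
by apply; exact: ballxx.
Qed.

Lemma continuous_expi : continuous (@expi R : R -> S1).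
Proof.
apply: continuous_comp_initial => t; apply/cvgrPdist_lt => e e0.
have [d Ed] : exists d : R, e = d%:C%C.
  by move: e0; case: e => a b; rewrite ltcE /= => /andP[/eqP -> _]; exists a.
have d0 : 0 < d by move: e0; rewrite Ed ltcR.
have d2 : 0 < d / 2 by rewrite divr_gt0.
near=> x; rewrite Ed normc_def ltcR /=.
have xc : `|cos t - cos x| < d / 2.
  by near: x; have /cvgrPdist_lt/(_ _ d2) := @continuous_cos R t.
have xs : `|sin t - sin x| < d / 2.
  by near: x; have /cvgrPdist_lt/(_ _ d2) := @continuous_sin R t.
rewrite -[ltRHS](@ger0_norm _ d) ?(ltW d0)// -sqrtr_sqr ltr_sqrt ?exprn_gt0//.
by move: xc xs; rewrite !ltr_norml => /andP[? ?] /andP[? ?]; nra.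
Unshelve. all: by end_near. Qed.

Lemma cosB_dist s t :
  cos (s - t) = 1 - normc (val (expi s) - val (expi t)) ^+ 2 / 2.
Proof.
rewrite /= sqr_sqrtr ?addr_ge0 ?sqr_ge0// cosB.
have := cos2Dsin2 s; have := cos2Dsin2 t; lra.
Qed.
End circle_facts.

(** * Arcs pulled back to separated sets *)

Section geometry.
Context {R : realType}.
Local Notation C := R[i].
Local Notation S1 := (unit_circle R).
Local Notation circ := (`[0, 2 * pi]%classic : set R).
Implicit Types (s t x y : R) (h k : S1 -> S1).

Lemma normc_normE (z : C) : `|z| = (normc z)%:C%C.
Proof. by case: z. Qed.

(** Where [h] and [k] differ, some point [expi p] has distinct preimages under
    [h] and under [k], and by continuity of the inverses the two preimages of a
    short arc at [expi p] stay apart. The arc is chosen not to cross the angle [2 * pi]. *)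
Lemma separated_preimages h k : homeomorphism h -> homeomorphism k -> h <> k ->
  exists p e c : R, [/\ 0 <= p, 0 < e, p + e <= 2 * pi, c < 1 &
    forall x y s t, p < s < p + e -> p < t < p + e ->
      h (expi x) = expi s -> k (expi y) = expi t -> cos (x - y) <= c].
Proof.
move=> [_ [g [cg hg gh]]] [_ [g' [cg' kg' g'k]]] hk.
have [z0 hkz] : exists z0, h z0 <> k z0.
  by apply: contrapT => /forallNP H; apply: hk; apply/funext => z; have /contrapT := H z.
have [p /andP[p0 p2] hp] := circle_expi (h z0).
pose w0 := g' (h z0).
have w0z0 : val z0 != val w0.
  by apply/eqP => /circle_eq E; apply: hkz; rewrite [in RHS]E /w0 g'k.
pose D := normc (val z0 - val w0).
have D0 : 0 < D.
  rewrite lt_neqAle normc_ge0 andbT eq_sym; apply: contra w0z0 => /eqP H.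
  by rewrite -subr_eq0 -normr_eq0 normc_normE [normc _]H.
have D40 : 0 < (D / 4)%:C%C :> C by rewrite ltcR divr_gt0.
have near_inverse (f : S1 -> S1) : continuous f -> \forall s \near p,
    normc (val (f (expi p)) - val (f (expi s))) < D / 4.
  move=> cf; have cvf : continuous (fun s => val (f (expi s)) : C^o).
    have cv : continuous (set_val : S1 -> C^o) := @initial_continuous _ _ _.
    have ce := @continuous_expi R.
    by move=> s; exact: (continuous_comp (continuous_comp (ce s) (cf _)) (cv _)).
  have /cvgrPdist_lt/(_ _ D40) := cvf p.
  by apply: filterS => s; rewrite normc_normE ltcR.
have [d /= d0 Hd] : \forall s \near p,
    normc (val (g (expi p)) - val (g (expi s))) < D / 4 /\
    normc (val (g' (expi p)) - val (g' (expi s))) < D / 4.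
  by apply: filterI; exact: near_inverse.
exists p, (Num.min d (2 * pi - p)), (1 - D ^+ 2 / 8); split => //.
- by rewrite lt_min d0 subr_gt0.
- by rewrite -lerBrDl ge_min lexx orbT.
- by rewrite gtrBl divr_gt0// exprn_gt0.
move=> x y s t sp tp hx ky.
have close r : p < r < p + Num.min d (2 * pi - p) -> ball p d r.
  move=> /andP[r1 r2]; rewrite /ball /= ltr_distlC.
  have : Num.min d (2 * pi - p) <= d by rewrite ge_min lexx.
  by move=> ?; apply/andP; split; lra.
have [xz _] := Hd s (close s sp); have [_ yw] := Hd t (close t tp).
rewrite -hx hg -hp hg in xz; rewrite -ky kg' -hp -/w0 in yw.
rewrite cosB_dist lerD2l lerN2.
set X := val (expi x) in xz *; set Y := val (expi y) in yw *.
have tri : D <= normc (val z0 - X) + normc (X - Y) + normc (val w0 - Y).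
  have -> : D = normc ((val z0 - X) + (X - Y) + - (val w0 - Y)).
    by rewrite /D; congr normc; ring.
  apply: le_trans (normc_triangle _ _) _; rewrite -(normcN (val w0 - Y)) lerD2r.
  exact: normc_triangle.
have XY : D / 2 <= normc (X - Y) by lra.
have : (D / 2) ^+ 2 <= normc (X - Y) ^+ 2.
  by rewrite lerXn2r ?nnegrE ?normc_ge0// ltW// divr_gt0.
lra.
Qed.

Lemma separatedC (f g : R -> R) : separated_supports f g -> separated_supports g f.
Proof.
move=> [c c1 fg]; exists c => // s t cs ct gs ft.
by rewrite -cosN opprB; exact: fg.
Qed.

Lemma separatedD (f g g' : R -> R) : separated_supports f g -> separated_supports f g' ->
  separated_supports f (fun t => g t + g' t).
Proof.
move=> [c c1 fg] [c' c1' fg']; exists (Num.max c c'); first by rewrite gt_max c1.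
move=> s t cs ct fs; rewrite le_max; have [gt|gt] := eqVneq (g t) 0.
  by rewrite gt add0r => /(fg' _ _ cs ct fs) ->; rewrite orbT.
by rewrite (fg _ _ cs ct fs gt).
Qed.

Lemma profileZ (c : R) (u : HalfFun R) t : profile (c%:C%C *: u) t = c * profile u t.
Proof.
rewrite /profile; have -> : (c%:C%C *: u) (expi t) = c%:C%C * u (expi t) by [].
by rewrite ReZ /= oppr0 mul0r addr0.
Qed.

(** Normalised bumps on pairwise separated arcs that accumulate at [expi p]. The
    arcs sit in the middle halves of the intervals [[p + b (i + 1), p + b i]],
    with [b] a decreasing null sequence; the margins [a i] separate them. *)
Lemma bump_family (p e : R) : 0 <= p -> 0 < e -> p + e <= 2 * pi ->
  exists u : nat -> HalfFun R, [/\ forall i z, 0 <= u i z,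
    forall i, continuous (profile (u i)),
    forall i t, circ t -> profile (u i) t != 0 -> p < t < p + e,
    forall i j, i != j -> separated_supports (profile (u i)) (profile (u j)) &
    forall i, Hhalf_seminorm (u i) = 1].
Proof.
move=> p0 e0 pe; pose d : R := Num.min e 1.
have d0 : 0 < d by rewrite lt_min e0 ltr01.
have de : d <= e by rewrite ge_min lexx.
have d1 : d <= 1 by rewrite ge_min lexx orbT.
pose b (i : nat) : R := d / i.+1%:R.
have b0 i : 0 < b i by rewrite divr_gt0.
have bd i : b i <= d by rewrite ler_piMr ?(ltW d0)// invf_le1// ler1n.
have bS i : b i.+1 < b i by rewrite ltr_pM2l// ltf_pV2 ?posrE// ltr_nat.
have bmono i j : (i < j)%N -> b j <= b i.+1.
  by move=> ij; rewrite ler_pM2l// lef_pV2 ?posrE// ler_nat.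
pose a i := (b i - b i.+1) / 4.
pose q i := p + (b i + b i.+1) / 2.
have a0 i : 0 < a i by rewrite divr_gt0// subr_gt0.
have api i : a i <= pi / 2.
  by rewrite /a; have := b0 i.+1; have := bd i; have := @pihalf_ge1 R; lra.
have qa i : a i <= q i by rewrite /a /q; have := b0 i; have := b0 i.+1; lra.
have aq i : q i <= 2 * pi - a i.
  by rewrite /a /q; have := b0 i.+1; have := bS i; have := bd i; lra.
pose n i := Hhalf_seminorm (bump_fun (a0 i) (api i) (qa i) (aq i)).
have n0 i : 0 < n i by exact: bump_fun_seminorm_gt0.
pose u i : HalfFun R := (n i)^-1%:C%C *: bump_fun (a0 i) (api i) (qa i) (aq i).
have uE i t : profile (u i) t = (n i)^-1 * profile (arc_bump (q i) (a i)) t by exact: profileZ.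
have usupp i t : circ t -> profile (u i) t != 0 -> p + b i.+1 + a i < t < p + b i.
  move=> ct; rewrite uE mulf_eq0 negb_or => /andP[_ /(bump_support (a0 i) (qa i) (aq i) ct)].
  rewrite ltr_norml /q /a => /andP[? ?]; have := bS i => ?; apply/andP; split; lra.
have usep i j : (i < j)%N -> separated_supports (profile (u i)) (profile (u j)).
  move=> ij; exists (cos (a i)).
    rewrite -cos0 ltr_cos ?in_itv /= ?lexx ?pi_ge0//; apply/andP; split; first exact: ltW.
    by have := api i; have := @pi_gt0 R; lra.
  move=> s t cs ct /(usupp i s cs)/andP[s1 s2] /(usupp j t ct)/andP[t1 t2].
  have bij := bmono _ _ ij; have bjp := b0 j.+1; have aj := a0 j; have ai := a0 i.
  have bi := bd i; have pi1 := @pihalf_ge1 R.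
  rewrite leNgt ltr_cos ?in_itv /= -?leNgt; first by lra.
    by apply/andP; split; lra.
  by apply/andP; split; lra.
exists u; split.
- move=> i z; rewrite (_ : u i z = (n i)^-1%:C%C * arc_bump (q i) (a i) z)//.
  by rewrite mulr_ge0 ?bump_ge0// lecR invr_ge0 ltW.
- move=> i; have -> : profile (u i) = fun t => (n i)^-1 * profile (arc_bump (q i) (a i)) t.
    by apply/funext => t; exact: uE.
  by move=> t; apply: cvgMr; exact: continuous_profile_bump.
- move=> i t ct /(usupp i t ct)/andP[t1 t2].
  have := b0 i.+1; have := bd i; have := a0 i => ? ? ?; apply/andP; split; lra.
- by move=> i j; rewrite neq_ltn => /orP[/usep//|/usep/separatedC].
- move=> i; rewrite /u Hhalf_seminormZ -/(n i) /= expr0n addr0 sqrtr_sqr.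
  by rewrite ger0_norm ?invr_ge0 ?(ltW (n0 i))// mulVf// gt_eqF.
Qed.

(** Expanding the square, all cross terms are nonpositive. *)
Lemma seminorm_sum_separated (u : nat -> HalfFun R) (s : seq nat) : uniq s ->
  (forall i z, 0 <= u i z) -> (forall i, Hhalf_seminorm (u i) = 1) ->
  (forall i j, i != j -> separated_supports (profile (u i)) (profile (u j))) ->
  Hhalf_seminorm (\sum_(i <- s) u i) ^+ 2 <= (size s)%:R.
Proof.
move=> us u0 u1 usep.
have sum_ge0 (l : seq nat) z : 0 <= (\sum_(i <- l) u i : HalfFun R) z.
  elim: l => [|i l IH]; first by rewrite big_nil.
  rewrite big_cons (_ : (u i + _) z = u i z + (\sum_(j <- l) u j : HalfFun R) z)//.
  exact: addr_ge0.
have sum_sep i (l : seq nat) : i \notin l ->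
    separated_supports (profile (u i)) (profile (\sum_(j <- l) u j : HalfFun R)).
  elim: l => [_|j l IH].
    by rewrite big_nil; exists 0 => // x y _ _ _; rewrite /profile /= eqxx.
  rewrite in_cons negb_or => /andP[ij il]; rewrite big_cons profileD.
  by under eq_fun do rewrite mul1r; apply: separatedD; [exact: usep|exact: IH].
elim: s us => [_|i s IH /= /andP[si us]].
  rewrite big_nil -(scale0r (0 : HalfFun R)) Hhalf_seminormZ normc0 mul0r.
  by rewrite expr0n.
rewrite big_cons; have [+ _] := seminorm_separated (u0 i) (sum_ge0 s) (sum_sep i s si).
move=> /le_trans; apply; rewrite u1 expr1n -nat1r lerD2l; exact: IH.
Qed.

End geometry.

(** * The essential norm of a difference of pull-backs *)

Section main.
Context {R : realType}.
Local Notation S1 := (unit_circle R).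
Implicit Types (h k : S1 -> S1) (V W K : {linear Hhalf R -> Hhalf R}).

Lemma rnorm_Hclass (u : HalfFun R) : rnorm (Hclass u) = Hhalf_seminorm u.
Proof. exact: Re_norm_Hclass. Qed.

Lemma Hclass_sum (u : nat -> HalfFun R) (s : seq nat) :
  \sum_(i <- s) Hclass (u i) = Hclass (\sum_(i <- s) u i).
Proof.
elim: s => [|i s IH]; first by rewrite !big_nil; apply/esym/raddf0.
by rewrite !big_cons HclassD IH.
Qed.

Lemma Hclass_sub (u v : HalfFun R) : Hclass (u - v) = Hclass u - Hclass v.
Proof. by apply/eqP; rewrite eq_sym subr_eq -HclassD subrK. Qed.

Lemma unit_vector : exists x : Hhalf R, rnorm x = 1.
Proof.
have [|u [_ _ _ _ u1]] := @bump_family R 0 1 (lexx 0) ltr01.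
  by have := @pi_ge2 R; lra.
by exists (Hclass (u 0%N)); rewrite rnorm_Hclass.
Qed.

Lemma pullback_nonneg h V (u : HalfFun R) : pullback_operator h V ->
  (forall z, 0 <= u z) -> continuous (profile u) ->
  exists2 v : HalfFun R, V (Hclass u) = Hclass v & forall z, v z = u (h z).
Proof.
move=> [_ hV] u0 cu; have [v Vv vE] := hV u; exists v => // z.
by rewrite vE precise_continuous//; exact: nonneg_real.
Qed.

(** The bumps of [bump_family], placed on an arc whose preimages under [h] and
    [k] are separated, are an almost orthogonal sequence on which [V \- W] is
    bounded below. *)
Lemma op_norm_pullback_sub h k V W K : homeomorphism h -> homeomorphism k ->
  h <> k -> pullback_operator h V -> pullback_operator k W -> compact_operator K ->
  Num.sqrt (min_modulus V ^+ 2 + min_modulus W ^+ 2) <= op_norm ((V \- W) \- K).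
Proof.
move=> hh hk nhk Vh Wk cK.
have [p [e [c [p0 e0 pe c1 Hc]]]] := separated_preimages hh hk nhk.
have [u [u0 cu usupp usep u1]] := bump_family p0 e0 pe.
have cVW : continuous (V \- W : {linear Hhalf R -> Hhalf R}).
  have [[cV _] _] := Vh; have [[cW _] _] := Wk.
  exact: (@continuous_sub_linear R (Hhalf R : normedModType R[i]) V W cV cW).
apply: (op_norm_ge_sequence cVW cK (x := fun i => Hclass (u i))).
- by move=> i; rewrite rnorm_Hclass.
- move=> s us; rewrite Hclass_sum rnorm_Hclass; exact: seminorm_sum_separated.
move=> i; have [v Vv vE] := pullback_nonneg Vh (u0 i) (cu i).
have [w Ww wE] := pullback_nonneg Wk (u0 i) (cu i).
have arc z : Re (u i z) != 0 -> exists2 s, p < s < p + e & z = expi s.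
  have [s /andP[s0 s2] ->] := circle_expi z => us; exists s => //.
  by apply: (usupp i) => //; rewrite /= in_itv /= s0 ltW.
have sep : separated_supports (profile v) (profile w).
  exists c => // x y _ _; rewrite /profile vE wE => /arc[s sp hx] /arc[t tp ky].
  exact: Hc sp tp hx ky.
rewrite /= Vv Ww -Hclass_sub rnorm_Hclass.
have v0 z : 0 <= v z by rewrite vE.
have w0 z : 0 <= w z by rewrite wE.
have [_ H] := seminorm_separated v0 w0 sep.
have mV := min_modulus_le V (Hclass (u i)).
have mW := min_modulus_le W (Hclass (u i)).
rewrite rnorm_Hclass u1 mulr1 Vv rnorm_Hclass in mV.
rewrite rnorm_Hclass u1 mulr1 Ww rnorm_Hclass in mW.
rewrite -[leRHS](@ger0_norm _ _ (Hhalf_seminorm_ge0 _)) -sqrtr_sqr ler_wsqrtr//.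
have sq (m b : R) : 0 <= m -> m <= b -> m ^+ 2 <= b ^+ 2.
  by move=> m0 mb; rewrite lerXn2r ?nnegrE// (le_trans m0).
apply: le_trans H; apply: lerD.
  exact: (sq _ _ (min_modulus_ge0 V) mV).
exact: (sq _ _ (min_modulus_ge0 W) mW).
Qed.

Lemma pullback_min_modulus_gt0 h V : pullback_operator h V -> 0 < min_modulus V.
Proof.
move=> [[_ [S [cS VS]]] _].
by have [] := min_modulus_inverse cS VS unit_vector.
Qed.

Lemma pullback_min_modulusE h V S : pullback_operator h V ->
  inverse_operator V S -> min_modulus V = (op_norm S)^-1.
Proof.
move=> [[_ [S' [cS' [VS' S'V]]]] _] VS.
have SS' : (S : Hhalf R -> Hhalf R) = S'.
  by apply/funext => x; rewrite -[in LHS](S'V x) VS.1.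
have cS : continuous S by rewrite SS'.
exact: (min_modulus_inverse cS VS unit_vector).2.
Qed.

(** The radius of isolation of [V] is its own minimum modulus. *)
Lemma pullbacks_discrete_of_ge (N : (Hhalf R -> Hhalf R) -> R) :
  (forall h k V W, homeomorphism h -> homeomorphism k -> h <> k ->
    pullback_operator h V -> pullback_operator k W ->
    Num.sqrt (min_modulus V ^+ 2 + min_modulus W ^+ 2) <= N (V \- W)) ->
  pullbacks_discrete N.
Proof.
move=> HN h V [hh _ _] Vh; exists (min_modulus V).
  exact: pullback_min_modulus_gt0 Vh.
move=> k W [hk _ _] Wk; apply: contraTP => kh; rewrite -leNgt.
apply: le_trans (HN h k V W hh hk _ Vh Wk); last by move=> E; apply: kh.
rewrite -[leLHS](@ger0_norm _ _ (ltW (pullback_min_modulus_gt0 Vh))) -sqrtr_sqr.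
by rewrite ler_wsqrtr// lerDl sqr_ge0.
Qed.

End main.

Theorem theorem1p1 (R : realType) :
  (forall (h k : unit_circle R -> unit_circle R)
      (Vh Vk Vh' Vk' : {linear Hhalf R -> Hhalf R}),
    quasisymmetric h -> quasisymmetric k -> h <> k ->
    pullback_operator h Vh -> pullback_operator k Vk ->
    inverse_operator Vh Vh' -> inverse_operator Vk Vk' ->
    ess_norm (Vh \- Vk) >=
      Num.sqrt (min_modulus Vh ^+ 2 + min_modulus Vk ^+ 2) /\
    Num.sqrt (min_modulus Vh ^+ 2 + min_modulus Vk ^+ 2) =
      Num.sqrt (op_norm Vh' ^- 2 + op_norm Vk' ^- 2)) /\
  pullbacks_discrete (@ess_norm R (Hhalf R)) /\
  pullbacks_discrete (@op_norm R (Hhalf R)).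
Proof.
split; last split.
- move=> h k V W V' W' [hh _ _] [hk _ _] nhk Vh Wk VV' WW'; split.
    by apply: ess_norm_ge => K cK; exact: (op_norm_pullback_sub hh hk).
  rewrite (pullback_min_modulusE Vh VV') (pullback_min_modulusE Wk WW').
  by move: (op_norm V') (op_norm W') => a b; rewrite !exprVn.
- apply: pullbacks_discrete_of_ge => h k V W hh hk nhk Vh Wk.
  by apply: ess_norm_ge => K cK; exact: (op_norm_pullback_sub hh hk).
- apply: pullbacks_discrete_of_ge => h k V W hh hk nhk Vh Wk.
  have := op_norm_pullback_sub hh hk nhk Vh Wk (@compact_operator0 _ _).
  by rewrite (_ : (V \- W) \- \0 = V \- W)//; apply/funext => x /=; rewrite subr0.
Qed.
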